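(* Let $(\alpha^*,\pi^* )$ be the true parameter of the stochastic block model, assume (A1), (A2), (A3) (see context) hold for $(\alpha^*,\pi^* )$ and all parameters considered, and let $(\widehat\alpha,\widehat\pi)=\operatorname{argmax}_{(\alpha,\pi)}\mathcal{L}_2(X_{[n]};\alpha,\pi)$ denote the maximum-likelihood estimator of $(\alpha^*,\pi^* )$. Assume $\|\widehat\pi-\pi^*\|_\infty=o_{\mathbb{P}}\left(\sqrt{\log n}/n\right)$. Then $$d(\widehat\alpha,\alpha^* )\xrightarrow[n\to+\infty]{\mathbb{P}}0,$$ where $d$ denotes any distance between vectors in $\mathbb{R}^Q$ (understood up to label switching leaving $\pi^*$ invariant, see context).
   Context: Stochastic block model (SBM): $Q$ is fixed and known. With parameters $(\alpha,\pi)$, where $\alpha$ is a probability vector in $(0,1)^Q$ and $\pi\in[0,1]^{Q\times Q}$, the labels $Z=(Z_i)_{i\geq1}$ are i.i.d. with $\mathbb{P}(Z_i=q)=\alpha_q$; given $Z$, the $X_{i,j}$, $i\neq j$, are independent Bernoulli$(\pi_{Z_i,Z_j})$, and $X_{i,i}=0$. $X_{[n]}=(X_{i,j})_{1\leq i,j\leq n}$. $\mathbb{P}$ is the law under $(\alpha^*,\pi^* )$ and $\xrightarrow{\mathbb{P}}$ is convergence in probability. $\|\cdot\|_\infty$ is the maximum of absolute values of the entries. Log-likelihoods: $\mathcal{L}_1(X_{[n]};z_{[n]},\pi)=\sum_{i\neq j}\{X_{i,j}\log\pi_{z_i,z_j}+(1-X_{i,j})\log(1-\pi_{z_i,z_j})\}$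 for $z_{[n]}\in\{1,\ldots,Q\}^n$, and $\mathcal{L}_2(X_{[n]};\alpha,\pi)=\log\left(\sum_{z_{[n]}}e^{\mathcal{L}_1(X_{[n]};z_{[n]},\pi)}\prod_{i=1}^n\alpha_{z_i}\right)$. Conventions: $0\log0=0$, $e^{-\infty}=0$, $\log0=-\infty$. The maximum is over parameters satisfying (A1)-(A3), and a maximizer is assumed to exist. Label switching: $\mathcal{L}_2$ is invariant under $(\alpha,\pi)\mapsto(\alpha^\sigma,\pi^\sigma)$ with $\alpha^\sigma_q=\alpha_{\sigma(q)}$, $\pi^\sigma_{q,l}=\pi_{\sigma(q),\sigma(l)}$, so $(\widehat\alpha,\widehat\pi)$ is defined up to such a relabelling; the hypothesis on $\widehat\pi$ refers to a labelling of $(\widehat\alpha,\widehat\pi)$ for which it holds, and the conclusion is for that labelling. Since labels related by $\mathfrak{S}^{\pi^*}=\{\sigma:(\pi^* )^\sigma=\pi^*\}$ are identified, $d(\widehat\alpha,\alpha^* )$ stands for $\min_{\sigma\in\mathfrak{S}^{\pi^*}}d_0(\widehat\alpha^\sigma,\alpha^* )$ with $d_0$ any distance on $\mathbb{R}^Q$ inducing the usual topology. (A1) for every $q\neq q'$ there is $l$ with $\pi_{q,l}\neq\pi_{q',l}$ or $\pi_{l,q}\neq\pi_{l,q'}$. (A2) for all $(q,l)$, $\pi_{q,l}\in(0,1)$ implies $\pi_{q,l}\in[\zeta,1-\zeta]$, with $\zeta>0$ a fixed constant not depending on $n$. (A3) $\alpha_q\in[\gamma,1-\gamma]$ for all $q$,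 with $0<\gamma<1/Q$ a fixed constant not depending on $n$. *)

(* Defs.v *)
From HB Require Import structures.
From mathcomp Require Import all_boot all_order all_algebra all_fingroup.
From mathcomp Require Import all_classical all_reals all_analysis.

Set Implicit Arguments.
Unset Strict Implicit.
Unset Printing Implicit Defensive.

Import Order.TTheory GRing.Theory Num.Theory.
Import numFieldNormedType.Exports.

Local Open Scope classical_set_scope.
Local Open Scope ring_scope.

Section SBM.
Context {R : realType} {Q : nat}.
Implicit Types (alpha : 'rV[R]_Q) (pi : 'M[R]_Q).

Definition sbm_param alpha pi : Prop :=
  [/\ forall q, 0 < alpha 0 q < 1,
      \sum_q alpha 0 q = 1
    & forall q l, 0 <= pi q l <= 1].

Definition A1 pi : Prop :=
  forall q q' : 'I_Q, q != q' ->
    exists l, pi q l != pi q' l \/ pi l q != pi l q'.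

Definition A2 (zeta : R) pi : Prop :=
  forall q l, 0 < pi q l < 1 -> zeta <= pi q l <= 1 - zeta.

Definition A3 (gamma : R) alpha : Prop :=
  forall q, gamma <= alpha 0 q <= 1 - gamma.

Definition admissible (zeta gamma : R) alpha pi : Prop :=
  [/\ sbm_param alpha pi, A1 pi, A2 zeta pi & A3 gamma alpha].

Section Likelihood.
Local Open Scope ereal_scope.

(* In \bar R one has 0 * -oo = 0, lne 0 = -oo and expeR -oo = 0, which are
   exactly the conventions needed when pi has entries equal to 0 or 1. *)
Definition L1 (n : nat) (x : 'M[bool]_n) (z : {ffun 'I_n -> 'I_Q}) pi : \bar R :=
  \sum_(i < n) \sum_(j < n | i != j)
    ((x i j)%:R%:E * lne (pi (z i) (z j))%:E +
     (1 - (x i j)%:R)%:E * lne (1 - pi (z i) (z j))%:E).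

Definition L2 (n : nat) (x : 'M[bool]_n) alpha pi : \bar R :=
  lne (\sum_(z : {ffun 'I_n -> 'I_Q})
         expeR (L1 x z pi) * (\prod_(i < n) alpha 0 (z i))%:E).

Definition is_mle (zeta gamma : R) (n : nat) (x : 'M[bool]_n) alpha pi : Prop :=
  admissible zeta gamma alpha pi /\
  forall alpha' pi', admissible zeta gamma alpha' pi' ->
    L2 x alpha' pi' <= L2 x alpha pi.

Definition mle_exists (zeta gamma : R) (n : nat) (x : 'M[bool]_n) : Prop :=
  exists alpha pi, is_mle zeta gamma x alpha pi.

End Likelihood.

(* (col_perm s alpha) 0 q = alpha 0 (s q) *)
Definition relabel_alpha (s : 'S_Q) alpha : 'rV[R]_Q := col_perm s alpha.

(* (row_perm s (col_perm s pi)) q l = pi (s q) (s l) *)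
Definition relabel_pi (s : 'S_Q) pi : 'M[R]_Q := row_perm s (col_perm s pi).

Definition stab_pi pi : {set 'S_Q} := [set s | relabel_pi s pi == pi]%SET.

Definition usual_distance (d0 : 'rV[R]_Q -> 'rV[R]_Q -> R) : Prop :=
  [/\ forall u v, d0 u v = 0 <-> u = v,
      forall u v, d0 u v = d0 v u,
      forall u v w, d0 u w <= d0 u v + d0 v w
    & forall u (A : set 'rV[R]_Q),
        nbhs u A <-> exists2 e, 0 < e & [set v | d0 u v < e] `<=` A].

(* The default value of the iterated minimum is the term of the identity
   permutation, which always belongs to stab_pi pi. *)
Definition dist_switch (d0 : 'rV[R]_Q -> 'rV[R]_Q -> R) pi
    (alpha alpha' : 'rV[R]_Q) : R :=
  \big[Num.min/d0 alpha alpha']_(s in stab_pi pi)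
    d0 (relabel_alpha s alpha) alpha'.

Section Model.
Context {d : measure_display} {T : measurableType d} (P : probability T R).

Definition cvg_probability (Y : nat -> T -> R) (l : R) : Prop :=
  forall eps : R, 0 < eps ->
    P [set w | eps < `|Y n w - l|] @[n --> \oo] --> 0%E.

Definition oP (Y : nat -> T -> R) (r : nat -> R) : Prop :=
  cvg_probability (fun n w => Y n w / r n) 0.

Definition adjacency (X : nat -> nat -> T -> bool) (n : nat) (w : T) :
  'M[bool]_n := \matrix_(i, j) X i j w.

Definition labels_are (Z : nat -> T -> 'I_Q) (n : nat)
    (z : {ffun 'I_n -> 'I_Q}) : set T :=
  [set w | forall i : 'I_n, Z i w = z i].

Definition edges_are (X : nat -> nat -> T -> bool) (n : nat)
    (x : 'M[bool]_n) : set T :=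
  [set w | forall i j : 'I_n, i != j -> X i j w = x i j].

(* All variables are discrete, so independence and the conditional law given
   the labels are expressed through point masses. The conditional law is
   written in product form, P(X = x, Z = z) = P(Z = z) P(X = x | Z = z), which
   avoids dividing by P(Z = z). *)
Record is_sbm (Z : nat -> T -> 'I_Q) (X : nat -> nat -> T -> bool) alpha pi :
    Prop := {
  sbm_measurable_label : forall i q, measurable [set w | Z i w = q] ;
  sbm_measurable_edge : forall i j, measurable_fun [set: T] (X i j) ;
  sbm_label_law : forall i q, P [set w | Z i w = q] = (alpha 0 q)%:E ;
  sbm_label_indep : forall n (z : {ffun 'I_n -> 'I_Q}),
    P (labels_are Z z) = (\prod_(i < n) P [set w | Z i w = z i])%E ;
  sbm_edge_law : forall n (z : {ffun 'I_n -> 'I_Q}) (x : 'M[bool]_n),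
    P (labels_are Z z `&` edges_are X x) =
    (P (labels_are Z z) *
     (\prod_(i < n) \prod_(j < n | i != j)
        bernoulli_pmf (pi (z i) (z j)) (x i j))%:E)%E ;
  sbm_no_loop : forall i w, X i i w = false }.

End Model.
End SBM.

(* Main.v *)
Require Import Defs.
From HB Require Import structures.
From mathcomp Require Import all_boot all_order all_algebra all_fingroup.
From mathcomp Require Import all_classical all_reals all_analysis.
From mathcomp Require Import ring lra.

Import Order.TTheory GRing.Theory Num.Theory.
Import numFieldNormedType.Exports.

Local Open Scope classical_set_scope.
Local Open Scope ring_scope.

(** Write W(z) for the likelihood of the graph given the labels z, and A(alpha, z)
    for the product of the alpha (z i). The marginal likelihood is
    V(alpha, pi) = sum_z W(z) A(alpha, z). Label likelihoods are of size
    exp (O(n)), whereas the likelihoods W separate labellings at the scale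
    exp (n ^ 2). An argument that loses factors exp (small * n) is therefore enough
    to locate the proportions.

    Let zs be the true labels. First, the graph identifies zs up to a small
    proportion of vertices and up to a permutation s fixing pis: a labelling
    which is not close to any s o zs gives many edges a wrong probability
    (exists_alignment), and a Hellinger bound with a union bound over all
    labellings shows that its likelihood W is below exp (- c n ^ 2) W(zs), with
    probability tending to 1 (wrong_label_tail, atypical_mass). By (A2), when
    pihat is within eta of pis the two matrices have the same entries 0 and 1,
    and replacing one by the other changes W by at most exp (C eta n ^ 2)
    (edge_lik_perturb); so the conclusion persists at pihat, and the labellings
    far from all the s o zs carry a negligible part of V(alphahat, pihat).

    Hence some s is such that the labellings close to s o zs carry a fixed
    fraction of V(alphahat, pihat). Relabel the true alphas into the admissible
    proportions alpha' with alpha' (s q) = alphas q. On these labellings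
    A(alpha', z) / A(alphahat, z) is, up to exp (small * n), the product over i of
    alphas (zs i) / alphahat (s (zs i)). Since
    V(alpha', pihat) <= V(alphahat, pihat), this product is at most
    exp (small * n) (mle_label_ratio). The class sizes of zs are close to
    n alphas q (class_size_tail), so the product is roughly
    exp (n KL(alphas, alphahat o s)), and a Hellinger lower bound on the
    divergence makes alphahat o s close to alphas (label_ratio_close). As s fixes
    pis, this bounds the distance up to label switching. *)

Set Implicit Arguments.
Unset Strict Implicit.
Unset Printing Implicit Defensive.

(** * Likelihoods as finite products and sums *)

Section Likelihood.
Context {R : realType} {Q n : nat}.
Implicit Types (x : 'M[bool]_n) (z : {ffun 'I_n -> 'I_Q}).
Implicit Types (alpha : 'rV[R]_Q) (pi : 'M[R]_Q).

(** Real-valued form of exp L1. As a product it needs no convention on log 0,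
    and entries of pi equal to 0 or 1 require no separate treatment. *)
Definition edge_lik x z pi : R :=
  \prod_(i < n) \prod_(j < n | i != j) bernoulli_pmf (pi (z i) (z j)) (x i j).

Definition label_lik alpha z : R := \prod_(i < n) alpha 0 (z i).

Definition marginal_lik x alpha pi : R :=
  \sum_z edge_lik x z pi * label_lik alpha z.

Lemma bernoulli_pmf_ge0_in (p : R) b : 0 <= p <= 1 -> 0 <= bernoulli_pmf p b.
Proof. by rewrite /bernoulli_pmf; case: b => /andP[? ?]; rewrite // subr_ge0. Qed.

Lemma edge_lik_ge0 x z pi :
  (forall q l, 0 <= pi q l <= 1) -> 0 <= edge_lik x z pi.
Proof.
move=> pi01; apply: prodr_ge0 => i _; apply: prodr_ge0 => j _.
exact: bernoulli_pmf_ge0_in.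
Qed.

Lemma label_lik_ge0 alpha z : (forall q, 0 <= alpha 0 q) -> 0 <= label_lik alpha z.
Proof. by move=> a0; apply: prodr_ge0. Qed.

Lemma expeR_L1 x z pi : (forall q l, 0 <= pi q l <= 1) ->
  expeR (L1 x z pi) = (edge_lik x z pi)%:E.
Proof.
move=> pi01.
rewrite /L1 (big_morph expeR (@expeRD R) (@expeR0 R)).
rewrite /edge_lik (big_morph EFin (@EFinM R) erefl); apply: eq_bigr => i _.
rewrite (big_morph expeR (@expeRD R) (@expeR0 R)).
rewrite (big_morph EFin (@EFinM R) erefl); apply: eq_bigr => j _.
have /andP[p0 p1] := pi01 (z i) (z j).
rewrite /bernoulli_pmf; case: (x i j).
  by rewrite subrr mul1e mul0e adde0 lneK// in_itv/= lee_fin p0 leey.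
by rewrite subr0 mul0e add0e mul1e lneK// in_itv/= lee_fin subr_ge0 p1 leey.
Qed.

Lemma L2_marginal_lik x alpha pi : (forall q l, 0 <= pi q l <= 1) ->
  L2 x alpha pi = lne (marginal_lik x alpha pi)%:E.
Proof.
move=> pi01; rewrite /L2 /marginal_lik (big_morph EFin (@EFinD R) erefl).
congr lne; apply: eq_bigr => z _.
rewrite expeR_L1// EFinM; congr (_ * _)%E.
Qed.

Lemma marginal_lik_ge0 x alpha pi : (forall q l, 0 <= pi q l <= 1) ->
  (forall q, 0 <= alpha 0 q) -> 0 <= marginal_lik x alpha pi.
Proof.
move=> pi01 a0; apply: sumr_ge0 => z _.
by rewrite mulr_ge0 ?edge_lik_ge0 ?label_lik_ge0.
Qed.

Lemma sbm_param_ge0 alpha pi : sbm_param alpha pi -> forall q, 0 <= alpha 0 q.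
Proof. by case=> a _ _ q; have /andP[/ltW] := a q. Qed.

Lemma sbm_param_pi01 alpha pi :
  sbm_param alpha pi -> forall q l, 0 <= pi q l <= 1.
Proof. by case. Qed.

(** Being a maximizer of L2 is used only through this inequality between finite
    sums of nonnegative reals. *)
Lemma mle_marginal_lik zeta gamma x alpha pi alpha' pi' :
  is_mle zeta gamma x alpha pi -> admissible zeta gamma alpha' pi' ->
  marginal_lik x alpha' pi' <= marginal_lik x alpha pi.
Proof.
move=> [[sp _ _ _] mx] adm'; have := mx _ _ adm'; case: adm' => sp' _ _ _.
have pi01 := sbm_param_pi01 sp; have pi01' := sbm_param_pi01 sp'.
rewrite (L2_marginal_lik _ _ pi01) (L2_marginal_lik _ _ pi01').
rewrite lee_lne ?lee_fin// in_itv/= lee_fin leey andbT marginal_lik_ge0//.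
- exact: sbm_param_ge0 sp'.
- exact: sbm_param_ge0 sp.
Qed.

End Likelihood.

(** * Alignment of two labellings with few conflicts *)

Section Alignment.
Context {R : realType} {Q n : nat}.
Implicit Types (z : {ffun 'I_n -> 'I_Q}) (pi : 'M[R]_Q).
Local Open Scope nat_scope.

Definition class_size z (q : 'I_Q) : nat := #|[set i | z i == q]%SET|.

(** Hamming distance between z' and the relabelling s o z. *)
Definition mismatch (s : 'S_Q) z z' : nat := #|[set i | z' i != s (z i)]%SET|.

(** Number of ordered pairs of distinct vertices whose edge has different
    probabilities under the two labellings. It governs how well the graph
    separates z' from z. *)
Definition conflict pi z z' : nat :=
  #|[set p : 'I_n * 'I_n |
      (p.1 != p.2) && (pi (z' p.1) (z' p.2) != pi (z p.1) (z p.2))]%SET|.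

Definition cell z z' q l : {set 'I_n} := [set i | (z i == q) && (z' i == l)]%SET.

(** Every off-diagonal pair of the product of the two cells is a conflict, and
    the diagonal has only n elements. *)
Lemma card_cell_mul pi z z' q l q' l' : pi l l' != pi q q' ->
  #|cell z z' q l| * #|cell z z' q' l'| <= conflict pi z z' + n.
Proof.
move=> ne; rewrite -cardsX -[X in _ + X]card_ord.
have -> : #|'I_n| = #|[set (i, i) | i in [set: 'I_n]]%SET|.
  by rewrite card_imset ?cardsT// => i j [].
apply: leq_trans (leq_card_setU _ _); apply: subset_leq_card.
apply/fintype.subsetP => -[i j]; rewrite !inE /= => /andP[/andP[/eqP-> /eqP->] /andP[/eqP-> /eqP->]].
have [<-|_ /=] := eqVneq i j; last by rewrite ne.
by rewrite imset_f ?orbT ?inE.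
Qed.

Lemma class_size_cells z z' q : class_size z q = \sum_l #|cell z z' q l|.
Proof.
rewrite /class_size -sum1_card (partition_big z' predT)//=.
apply: eq_bigr => l _; rewrite -sum1_card; apply: eq_bigl => i.
by rewrite !inE.
Qed.

(** Call a cell (q, l) large if it holds at least t n vertices. With few
    conflicts, two large cells (q, l) and (q', l') satisfy pi l l' = pi q q'.
    Each class, being large, meets some label f q in a large cell; by (A1) two
    labels with the same connection probabilities coincide, which makes f
    injective and forces every large cell to be of the form (q, f q). Hence f is
    a permutation fixing pi, and all the mismatched vertices lie in small
    cells. *)
Lemma exists_alignment pi z z' (t : R) :
  A1 pi -> (0 <= t)%R ->
  (forall q, (Q%:R * (t * n%:R) <= (class_size z q)%:R)%R) ->
  ((conflict pi z z')%:R + n%:R < (t * n%:R) ^+ 2)%R ->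
  exists2 s, s \in stab_pi pi &
    ((mismatch s z z')%:R <= Q%:R ^+ 2 * (t * n%:R))%R.
Proof.
move=> a1 t0 hsize hconf.
pose large q l := (t * n%:R <= #|cell z z' q l|%:R)%R.
have tn0 : (0 <= t * n%:R)%R by rewrite mulr_ge0.
have agree q l q' l' : large q l -> large q' l' -> pi l l' = pi q q'.
  move=> h h'; apply/eqP; apply: contraLR hconf => /card_cell_mul.
  move=> /(_ z z'); rewrite -leNgt -(ler_nat R) natrD => /(le_trans _); apply.
  by rewrite natrM expr2 ler_pM.
have [f hf] : exists f : {ffun 'I_Q -> 'I_Q}, forall q, large q (f q).
  suff /fin_all_exists[f hf] : forall q, exists l, large q l.
    by exists (finfun f) => q; rewrite ffunE.
  move=> q; apply/existsP; apply: contraLR (hsize q).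
  rewrite negb_exists => /forallP small.
  rewrite (class_size_cells z z' q) natr_sum -ltNge.
  have -> : (Q%:R * (t * n%:R) = \sum_(l < Q) t * n%:R)%R.
    by rewrite sumr_const card_ord mulr_natl.
  apply: ltr_sum => [|l _]; last by rewrite ltNge; exact: small.
  by apply/hasP; exists q; rewrite ?mem_index_enum.
have finj : injective f.
  move=> q q' fqq'; apply/eqP; apply/negP => /negP /a1[l].
  rewrite -(agree _ _ _ _ (hf q) (hf l)) -(agree _ _ _ _ (hf q') (hf l)).
  rewrite -(agree _ _ _ _ (hf l) (hf q)) -(agree _ _ _ _ (hf l) (hf q')).
  by rewrite fqq' !eqxx; case.
have large_f q l : large q l -> l = f q.
  move=> lql; apply/eqP; apply/negP => /negP /a1[m].
  rewrite -(permKV (perm finj) m) permE; set m' := (_ m).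
  rewrite (agree _ _ _ _ lql (hf m')) (agree _ _ _ _ (hf m') lql).
  rewrite (agree _ _ _ _ (hf q) (hf m')) (agree _ _ _ _ (hf m') (hf q)).
  by rewrite !eqxx; case.
exists (perm finj).
  rewrite inE; apply/eqP/matrixP => q l; rewrite !mxE !permE.
  exact: agree.
rewrite /mismatch -sum1_card (partition_big (fun i => (z i, z' i)) predT)//=.
rewrite natr_sum.
have -> : (Q%:R ^+ 2 * (t * n%:R) = \sum_(p : 'I_Q * 'I_Q) t * n%:R)%R.
  by rewrite sumr_const card_prod card_ord -[RHS]mulr_natl natrM expr2.
apply: ler_sum => -[q l] _.
have [->|lf] := eqVneq l (f q).
  rewrite big_pred0// => i; rewrite !inE permE xpair_eqE.
  by apply/negP => /and3P[ne /eqP zq /eqP z'q]; rewrite zq z'q eqxx in ne.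
apply: (@le_trans _ _ #|cell z z' q l|%:R).
  rewrite ler_nat sum1_card; apply: subset_leq_card.
  by apply/fintype.subsetP => i; rewrite !inE => /andP[].
apply: ltW; rewrite ltNge; apply/negP => /large_f lE.
by rewrite lE eqxx in lf.
Qed.
End Alignment.

(** * Stability of the edge likelihood in the connection probabilities *)

Section Perturbation.
Context {R : realType}.

(** By (A2), p = 0 and p' within eta < min (zeta, 1) of p force p' = 0, so that p and p'
    have the same zeros and their ratio is controlled by eta / zeta. The lemma
    is applied to (p, p') and to (1 - p, 1 - p'). *)
Lemma le_prob_perturb (zeta eta p p' : R) :
  0 < zeta -> 0 <= eta -> eta < zeta -> eta < 1 ->
  0 <= p <= 1 -> 0 <= p' <= 1 ->
  (0 < p < 1 -> zeta <= p) -> (0 < p' < 1 -> zeta <= p') ->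
  `|p' - p| <= eta -> p' <= expR (eta / zeta) * p.
Proof.
move=> z0 e0 ez e1 /andP[p0 p1] /andP[p0' p1'] hp hp' hd.
have hle : p' <= p + eta by move: hd; rewrite ler_norml => /andP[_]; lra.
have hex : 1 + eta / zeta <= expR (eta / zeta) by exact: expR_ge1Dx.
have [pE|pn0] := eqVneq p 0.
  have [->|pn0'] := eqVneq p' 0; first by rewrite pE mulr0.
  have : zeta <= p' by apply: hp'; rewrite lt_neqAle eq_sym pn0' p0' /=; lra.
  lra.
apply: le_trans (ler_wpM2r p0 hex).
have r0 : 0 <= eta / zeta by rewrite divr_ge0// ltW.
have [->|pn1] := eqVneq p 1; first by lra.
have zp : zeta <= p.
  by apply: hp; rewrite lt_neqAle eq_sym pn0 p0 lt_neqAle pn1 p1.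
apply: le_trans hle _; rewrite mulrDl mul1r lerD2l.
by rewrite -[leLHS](divfK (lt0r_neq0 z0)) ler_wpM2l.
Qed.

Lemma edge_lik_perturb {Q n} (x : 'M[bool]_n) z (zeta eta : R) (pi pi' : 'M[R]_Q) :
  0 < zeta -> eta < zeta -> eta < 1 ->
  (forall q l, 0 <= pi q l <= 1) -> (forall q l, 0 <= pi' q l <= 1) ->
  A2 zeta pi -> A2 zeta pi' -> `|pi' - pi| <= eta ->
  edge_lik x z pi' <= expR (eta / zeta * n%:R ^+ 2) * edge_lik x z pi.
Proof.
move=> z0 ez e1 p01 p01' a2 a2' hd.
have e0 : 0 <= eta by exact: le_trans hd.
have step i j : bernoulli_pmf (pi' (z i) (z j)) (x i j) <=
    expR (eta / zeta) * bernoulli_pmf (pi (z i) (z j)) (x i j).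
  have h : `|pi' (z i) (z j) - pi (z i) (z j)| <= eta.
    apply: le_trans hd; rewrite [leRHS]mx_normrE.
    have -> : pi' (z i) (z j) - pi (z i) (z j) = (pi' - pi) (z i) (z j).
      by rewrite !mxE.
    exact: (le_bigmax _ _ (z i, z j)).
  have a := a2 (z i) (z j); have a' := a2' (z i) (z j).
  have := p01 (z i) (z j); have := p01' (z i) (z j).
  move: h a a'; set p := pi _ _; set p' := pi' _ _ => h a a' q01' q01.
  rewrite /bernoulli_pmf; case: (x i j).
    by apply: le_prob_perturb => // [/a|/a'] /andP[].
  apply: le_prob_perturb => //; [lra|lra| | |].
  - by move=> ?; have := a; lra.
  - by move=> ?; have := a'; lra.
  - by have -> : 1 - p' - (1 - p) = p - p' by [ring]; rewrite distrC.
have -> : expR (eta / zeta * n%:R ^+ 2) =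
    \prod_(i < n) \prod_(j < n) expR (eta / zeta).
  by rewrite !prodr_const card_ord -!expRM_natl; congr expR; ring.
rewrite /edge_lik -big_split/=; apply: ler_prod => i _; apply/andP; split.
  by apply: prodr_ge0 => j _; exact: bernoulli_pmf_ge0_in.
rewrite 2!(big_mkcond (fun j => i != j)) -big_split/=.
apply: ler_prod => j _; case: ifP => _.
  by rewrite bernoulli_pmf_ge0_in/=.
by rewrite ler01 mulr1 -expR0 ler_expR divr_ge0// ltW.
Qed.

End Perturbation.

(** * Label likelihoods at a maximizer *)

Section Comparison.
Context {R : realType} {Q n : nat}.
Implicit Types (z : {ffun 'I_n -> 'I_Q}) (alpha : 'rV[R]_Q).

(** Replacing alpha by alpha' changes the likelihood of z and that of s o zs by
    the same factor, up to the coordinates where these two labellings differ;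
    each of those costs at most gamma ^ 2. *)
Lemma label_lik_mismatch (gamma : R) (s : 'S_Q) zs z alpha alpha' :
  0 <= gamma -> (forall q, gamma <= alpha 0 q <= 1) ->
  (forall q, gamma <= alpha' 0 q <= 1) ->
  (gamma ^+ 2) ^+ mismatch s zs z *
    (label_lik alpha z * label_lik alpha' [ffun i => s (zs i)]) <=
  label_lik alpha' z * label_lik alpha [ffun i => s (zs i)].
Proof.
move=> g0 ha ha'; rewrite -prodr_const big_mkcond/= -!big_split/=.
apply: ler_prod => i _; rewrite ffunE inE.
have /andP[a1 a2] := ha (z i); have /andP[b1 b2] := ha' (z i).
have /andP[c1 c2] := ha (s (zs i)); have /andP[d1 d2] := ha' (s (zs i)).
have [->|_] /= := eqVneq (z i) (s (zs i)).
  by rewrite mul1r [X in _ <= X <= _]mulrC lexx andbT mulr_ge0// (le_trans g0).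
rewrite mulr_ge0 ?mulr_ge0 ?exprn_ge0 ?(le_trans g0)//=.
apply: (@le_trans _ _ (gamma ^+ 2 * 1)).
  by rewrite ler_wpM2l ?exprn_ge0// mulr_ile1// (le_trans g0).
by rewrite mulr1 expr2 ler_pM.
Qed.

Lemma sum_label_lik alpha :
  \sum_(z : {ffun 'I_n -> 'I_Q}) label_lik alpha z = (\sum_q alpha 0 q) ^+ n.
Proof.
rewrite /label_lik -(bigA_distr_bigA (fun (i : 'I_n) q => alpha 0 q)).
by rewrite prodr_const card_ord.
Qed.

Lemma label_lik_gt0 alpha z : (forall q, 0 < alpha 0 q) -> 0 < label_lik alpha z.
Proof. by move=> a0; apply: prodr_gt0. Qed.

Lemma admissible_relabel (zeta gamma : R) alpha alpha' pi pi' s :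
  admissible zeta gamma alpha pi -> admissible zeta gamma alpha' pi' ->
  admissible zeta gamma (relabel_alpha s alpha) pi'.
Proof.
move=> [[a01 sa _] _ _ a3] [[_ _ p01] a1 a2 _]; split=> //.
- split=> // [q|]; first by rewrite mxE.
  by rewrite -sa [RHS](reindex_perm s); apply: eq_bigr => q _; rewrite mxE.
- by move=> q; rewrite mxE.
Qed.

(** The central comparison. Call z near s if it has at most delta mismatches with
    s o zs. Labellings near no s carry at most half of the maximal marginal
    likelihood V, so the part T of V carried by the labellings near some s is at
    least of order V. Compare alphah with the competitor alpha' obtained from
    alphas by the relabelling which makes alpha' (s q) = alphas q: on the
    labellings near s the ratio of the two label likelihoods is essentially
    constant, equal to its value at s o zs, so V >= marginal(alpha') is at least
    T times that ratio. Therefore the ratio is bounded. A sum over all s replaces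
    the choice of a good one.

    The competitor depends on s because pih need not be invariant under s: the
    neighbourhoods of the various s o zs may carry very different parts of V. *)
Lemma mle_label_ratio (zeta gamma delta E : R) (x : 'M[bool]_n) zs
    (alphas : 'rV[R]_Q) pis alphah pih :
  0 < gamma -> 0 < E ->
  (forall h : nat, h%:R <= delta -> E <= (gamma ^+ 2) ^+ h) ->
  admissible zeta gamma alphas pis -> is_mle zeta gamma x alphah pih ->
  0 < edge_lik x zs pih ->
  (forall z, (forall s, s \in stab_pi pis -> delta < (mismatch s zs z)%:R) ->
     2 * edge_lik x z pih <= gamma ^+ n * edge_lik x zs pih) ->
  exists2 s, s \in stab_pi pis &
    E * label_lik alphas zs <=
    2 * #|stab_pi pis|%:R * label_lik alphah [ffun i => s (zs i)].
Proof.
move=> g0 E0 hE adm mle wzs hfar.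
have [admh _] := mle; have [[ah01 sah ph01] _ _ ah3] := admh.
have hah q : gamma <= alphah 0 q <= 1.
  by have /andP[-> _] := ah3 q; have /andP[_ /ltW] := ah01 q.
have ahge0 q : 0 <= alphah 0 q by have /andP[/ltW] := ah01 q.
apply/exists_inP; apply: contraT; rewrite negb_exists_in => /forall_inP no.
set V := marginal_lik x alphah pih.
have Vzs : gamma ^+ n * edge_lik x zs pih <= V.
  rewrite /V /marginal_lik (bigD1 zs)//= ler_wpDr//.
    apply: sumr_ge0 => z _.
    by rewrite mulr_ge0 ?label_lik_ge0 ?edge_lik_ge0.
  rewrite mulrC ler_wpM2l ?edge_lik_ge0//.
  rewrite -[X in gamma ^+ X]card_ord -prodr_const; apply: ler_prod => i _.
  by have /andP[-> _] := hah (zs i); rewrite ltW.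
have V0 : 0 < V by apply: lt_le_trans Vzs; rewrite mulr_gt0 ?exprn_gt0.
pose near s z := (mismatch s zs z)%:R <= delta.
pose far z := [forall s in stab_pi pis, ~~ near s z].
pose term z := edge_lik x z pih * label_lik alphah z.
have term0 z : 0 <= term z by rewrite mulr_ge0 ?label_lik_ge0 ?edge_lik_ge0.
have far_small : \sum_(z | far z) term z <= V / 2.
  apply: (@le_trans _ _ (\sum_(z | far z)
      (gamma ^+ n * edge_lik x zs pih / 2) * label_lik alphah z)).
    apply: ler_sum => z /forall_inP fz; rewrite ler_wpM2r ?label_lik_ge0//.
    rewrite ler_pdivlMr// mulrC; apply: hfar => s /fz.
    by rewrite ltNge.
  rewrite -mulr_sumr; apply: (@le_trans _ _
    (gamma ^+ n * edge_lik x zs pih / 2 * 1)).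
    rewrite ler_wpM2l ?divr_ge0 ?mulr_ge0 ?exprn_ge0 ?edge_lik_ge0 ?(ltW g0)//.
    apply: (@le_trans _ _ (\sum_(z : {ffun 'I_n -> 'I_Q}) label_lik alphah z)).
      rewrite big_mkcond/=; apply: ler_sum => z _.
      by case: ifP => // _; exact: label_lik_ge0.
    by rewrite sum_label_lik sah expr1n.
  by rewrite mulr1 ler_pM2r// invr_gt0.
have near_small s : s \in stab_pi pis ->
    \sum_(z | near s z) term z < V / 2 / #|stab_pi pis|%:R.
  move=> sS; set T := \sum_(z | _) _.
  have c0 : (0 : R) < #|stab_pi pis|%:R.
    by rewrite ltr0n; apply/card_gt0P; exists s.
  pose alpha' := relabel_alpha s^-1 alphas.
  have adm' : admissible zeta gamma alpha' pih by exact: admissible_relabel adm admh.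
  have hV := mle_marginal_lik mle adm'.
  have [[a01' _ _] _ _ a3'] := adm'.
  have ha' q : gamma <= alpha' 0 q <= 1.
    by have /andP[-> _] := a3' q; have /andP[_ /ltW] := a01' q.
  have age0' q : 0 <= alpha' 0 q by have /andP[/ltW] := a01' q.
  set szs : {ffun 'I_n -> 'I_Q} := [ffun i => s (zs i)] in no *.
  have lE : label_lik alpha' szs = label_lik alphas zs.
    by apply: eq_bigr => i _; rewrite mxE ffunE permK.
  have A0 : 0 < label_lik alphas zs.
    by have [[a01 _ _] _ _ _] := adm; apply: label_lik_gt0 => q;
      have /andP[] := a01 q.
  have lb : T * (E * label_lik alphas zs) <= V * label_lik alphah szs.
    apply: (@le_trans _ _ (marginal_lik x alpha' pih * label_lik alphah szs)).
      rewrite /T /marginal_lik !mulr_suml [leLHS]big_mkcond/=.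
      apply: ler_sum => z _; case: ifP => [nz|_]; last first.
        by rewrite !mulr_ge0 ?label_lik_ge0 ?edge_lik_ge0.
      rewrite /term -!mulrA ler_wpM2l ?edge_lik_ge0//.
      apply: le_trans (label_lik_mismatch s zs z (ltW g0) hah ha').
      rewrite -/szs lE mulrCA ler_wpM2r ?hE//.
      exact: mulr_ge0 (label_lik_ge0 _ ahge0) (ltW A0).
    by rewrite ler_wpM2r ?label_lik_ge0.
  have := no _ sS; rewrite -ltNge => {}no.
  rewrite -mulrA -invfM ltr_pdivlMr ?mulr_gt0//.
  rewrite -(ltr_pM2r (mulr_gt0 E0 A0)).
  rewrite mulrAC; apply: le_lt_trans (_ : V * (2 * #|stab_pi pis|%:R * label_lik alphah szs) < _).
    rewrite [leRHS]mulrCA [leRHS]mulrC; apply: ler_wpM2r; last by [].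
    by rewrite mulr_ge0.
  by rewrite ltr_pM2l.
have S0 : (0 < #|stab_pi pis|)%N.
  apply/card_gt0P; exists 1%g; rewrite inE; apply/eqP/matrixP => q l.
  by rewrite !mxE !perm1.
(* Every labelling is far or near some s; the bounds near_small are strict and
   there is at least one of them. *)
have : V < V.
  apply: (@le_lt_trans _ _ (\sum_(s in stab_pi pis) \sum_(z | near s z) term z
      + \sum_(z | far z) term z)).
    rewrite (exchange_big_dep predT)//=.
    rewrite [X in _ <= _ + X]big_mkcond -big_split/=; apply: ler_sum => z _.
    case: ifPn => [_|]; first by rewrite ler_wpDl// sumr_ge0.
    rewrite negb_forall_in => /exists_inP[s sS]; rewrite negbK => nz.
    rewrite addr0 (bigD1 s)/= ?sS// ler_wpDr// sumr_ge0//.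
  rewrite [ltRHS](splitr V); apply: ltr_leD far_small.
  have -> : V / 2 = \sum_(s in stab_pi pis) V / 2 / #|stab_pi pis|%:R.
    by rewrite sumr_const -[RHS]mulr_natr divfK// pnatr_eq0 -lt0n.
  apply: ltr_sum near_small.
  by apply/hasP; have [s sS] := card_gt0P S0; exists s; rewrite ?mem_index_enum.
by rewrite ltxx.
Qed.

End Comparison.

(** * From a bounded likelihood ratio to close proportions *)

Section LabelRatio.
Context {R : realType} {Q n : nat}.

Lemma sum_class_size (zs : {ffun 'I_n -> 'I_Q}) (f : 'I_Q -> R) :
  \sum_i f (zs i) = \sum_q (class_size zs q)%:R * f q.
Proof.
rewrite (partition_big zs predT)//=; apply: eq_bigr => q _.
rewrite /class_size -sum1_card natr_sum mulr_suml.
apply: eq_big => [i|i /eqP->]; first by rewrite inE.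
by rewrite mul1r.
Qed.

(** A Hellinger form of the fact that sum_q alpha q * ln (beta q) is maximal only
    at beta = alpha: with y = sqrt (beta / alpha), the bound y <= exp (y - 1) turns
    the lower bound on the product of the y (zs i) into a lower bound on
    sum_q N_q (y q - 1). Since N_q is close to n alpha q, the latter is close to
    - n / 2 * sum_q (sqrt (alpha q) - sqrt (beta q)) ^ 2. *)
Lemma label_ratio_close (gamma eps c : R) (zs : {ffun 'I_n -> 'I_Q})
    (alpha beta : 'I_Q -> R) :
  (0 < n)%N -> 0 < gamma -> 0 <= eps ->
  (forall q, gamma <= alpha q <= 1) -> (forall q, gamma <= beta q <= 1) ->
  \sum_q alpha q = 1 -> \sum_q beta q = 1 ->
  (forall q, `|(class_size zs q)%:R - n%:R * alpha q| <= eps * n%:R) ->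
  expR (- (2 * c)) * \prod_i alpha (zs i) <= \prod_i beta (zs i) ->
  forall q, (beta q - alpha q) ^+ 2 <=
    8 * (c / n%:R + eps * Q%:R * (gamma^-1 + 1)).
Proof.
move=> n0 g0 e0 ha hb sa sb hN hr q.
have nR : (0 : R) < n%:R by rewrite ltr0n.
pose a q := Num.sqrt (alpha q); pose b q := Num.sqrt (beta q).
have a0 k : 0 < a k by rewrite sqrtr_gt0 (lt_le_trans g0)//; have /andP[] := ha k.
have b0 k : 0 < b k by rewrite sqrtr_gt0 (lt_le_trans g0)//; have /andP[] := hb k.
have a2 k : a k ^+ 2 = alpha k.
  by rewrite sqr_sqrtr// (le_trans (ltW g0))//; have /andP[] := ha k.
have b2 k : b k ^+ 2 = beta k.
  by rewrite sqr_sqrtr// (le_trans (ltW g0))//; have /andP[] := hb k.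
have a1 k : a k <= 1.
  by rewrite -sqrtr1 ler_sqrt//; have /andP[] := ha k.
have b1 k : b k <= 1.
  by rewrite -sqrtr1 ler_sqrt//; have /andP[] := hb k.
pose y k := b k / a k.
have y0 k : 0 < y k by rewrite divr_gt0.
have ay k : alpha k * y k = a k * b k.
  by rewrite -a2 /y expr2 -mulrA mulrCA [_ / _]mulrC mulVKf ?lt0r_neq0// mulrC.
have yb k : y k <= gamma^-1.
  have ga : gamma <= a k.
    have /andP[ga _] := ha k; apply: le_trans ga _; rewrite -a2 expr2.
    by rewrite ler_piMr// ltW.
  apply: (@le_trans _ _ (1 / a k)); first by rewrite ler_pM2r ?invr_gt0.
  by rewrite div1r lef_pV2 ?posrE.
(* The square root of the hypothesis, divided by the product of the alpha (zs i). *)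
have py : expR (- c) <= \prod_i y (zs i).
  have p0 : 0 <= \prod_i y (zs i) by apply: prodr_ge0 => i _; exact: ltW.
  rewrite -(ler_pXn2r (n := 2))// ?nnegrE ?expR_ge0//.
  rewrite -expRM_natl mulrN -prodrXl.
  have pa : 0 < \prod_i alpha (zs i).
    by apply: prodr_gt0 => i _; rewrite -a2 exprn_gt0.
  rewrite -(ler_pM2r pa) (le_trans hr)// -big_split/=.
  rewrite le_eqVlt; apply/orP; left; apply/eqP; apply: eq_bigr => i _.
  by rewrite -a2 -b2 /y expr_div_n divfK// sqrf_eq0 lt0r_neq0.
have hs : - c <= \sum_k (class_size zs k)%:R * (y k - 1).
  rewrite -(sum_class_size zs (fun k => y k - 1)) -ler_expR expR_sum.
  apply: le_trans py _; apply: ler_prod => i _; rewrite ltW//=.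
  by apply: le_trans (expR_ge1Dx _); rewrite addrC subrK.
have hs2 : - c <= \sum_k (n%:R * (a k * b k - alpha k) +
    eps * n%:R * (gamma^-1 + 1)).
  apply: le_trans hs _; apply: ler_sum => k _.
  have -> : a k * b k - alpha k = alpha k * (y k - 1) by rewrite mulrBr ay mulr1.
  rewrite mulrA -lerBlDl -mulrBl; apply: le_trans (ler_norm _) _.
  rewrite normrM ler_pM//; have := yb k; have := y0 k.
  by move=> ? ?; rewrite ler_norml; apply/andP; split; lra.
(* Both vectors sum to 1, so the linear part of the squares cancels. *)
have sumE : \sum_k (a k * b k - alpha k) = - (\sum_k (a k - b k) ^+ 2) / 2.
  have -> : \sum_k (a k - b k) ^+ 2 =
      \sum_k (alpha k + beta k - 2 * (a k * b k)).
    by apply: eq_bigr => k _; rewrite -a2 -b2; ring.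
  rewrite !sumrB -mulr_sumr big_split/= sa sb; lra.
have hq : (a q - b q) ^+ 2 <= \sum_k (a k - b k) ^+ 2.
  rewrite (bigD1 q)//= lerDl; apply: sumr_ge0 => k _; exact: sqr_ge0.
have main : (a q - b q) ^+ 2 <= 2 * (c / n%:R + eps * Q%:R * (gamma^-1 + 1)).
  apply: le_trans hq _; move: hs2; rewrite big_split/= -mulr_sumr sumE.
  rewrite sumr_const card_ord -[_ *+ Q]mulr_natr.
  set S := \sum_k _; set G := gamma^-1 + 1 => hs2.
  rewrite -(ler_pM2l nR).
  have -> : n%:R * (2 * (c / n%:R + eps * Q%:R * G)) =
     2 * (c + eps * n%:R * G * Q%:R) by field; rewrite lt0r_neq0.
  by lra.
rewrite -b2 -a2 subr_sqr exprMn -[(b q - a q) ^+ 2]sqrrN opprB.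
have -> : 8 * (c / n%:R + eps * Q%:R * (gamma^-1 + 1)) =
  2 * (c / n%:R + eps * Q%:R * (gamma^-1 + 1)) * 2 ^+ 2 by ring.
rewrite ler_pM ?sqr_ge0//.
rewrite ler_pXn2r ?nnegrE ?addr_ge0 ?(ltW (a0 q)) ?(ltW (b0 q))//.
have := a1 q; have := b1 q; lra.
Qed.

End LabelRatio.

(** * Sums over matrices *)

Section FiniteTools.
Context {R : realType}.

Lemma sqrtr_prod (I : Type) (r : seq I) (p : pred I) (f : I -> R) :
  (forall i, p i -> 0 <= f i) ->
  Num.sqrt (\prod_(i <- r | p i) f i) = \prod_(i <- r | p i) Num.sqrt (f i).
Proof.
move=> f0; elim/big_rec2: _ => [|i y x pi <-]; first by rewrite sqrtr1.
by rewrite sqrtrM ?f0.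
Qed.

Lemma finite_gap (I : finType) (p : pred I) (f : I -> R) :
  (forall i, p i -> 0 < f i) -> exists2 h, 0 < h & forall i, p i -> h <= f i.
Proof.
move=> f0; exists (\big[Num.min/1]_(i | p i) f i).
  by apply: lt_bigmin.
by move=> i pi; exact: bigmin_le_cond.
Qed.

(** Independence of the entries of a random matrix, in the form of
    distributivity. *)
Lemma sum_matrix_prod (n : nat) (f : 'I_n -> 'I_n -> bool -> R) :
  \sum_(x : 'M[bool]_n) \prod_i \prod_j f i j (x i j) =
  \prod_i \prod_j (f i j true + f i j false).
Proof.
rewrite pair_big/= [LHS](reindex (fun g : {ffun 'I_n * 'I_n -> bool} => Matrix g))/=.
  transitivity (\prod_(p : 'I_n * 'I_n) \sum_(b : bool) f p.1 p.2 b).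
    rewrite bigA_distr_bigA/=; apply: eq_bigr => g _; rewrite pair_big/=.
    by apply: eq_bigr => -[i j] _.
  by apply: eq_bigr => p _; rewrite big_bool.
by exists (fun x : 'M[bool]_n => mx_val x) => [g _|[g] _].
Qed.

Definition loopless n (x : 'M[bool]_n) := [forall i, ~~ x i i].

Lemma sum_loopless_prod (n : nat) (f : 'I_n -> 'I_n -> bool -> R) :
  \sum_(x : 'M[bool]_n | loopless x) \prod_i \prod_(j | i != j) f i j (x i j) =
  \prod_i \prod_(j | i != j) (f i j true + f i j false).
Proof.
(* A diagonal entry that may only be false, with weight 1. *)
pose g i j b := if i == j then (~~ b)%:R else f i j b.
transitivity (\prod_i \prod_j (g i j true + g i j false)); last first.
  apply: eq_bigr => i _; rewrite [RHS]big_mkcond; apply: eq_bigr => j _.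
  by rewrite /g; case: eqP => //= _; rewrite add0r.
rewrite -sum_matrix_prod [LHS]big_mkcond; apply: eq_bigr => x _.
case: ifPn => [/forallP lx|].
  apply: eq_bigr => i _; rewrite [LHS]big_mkcond; apply: eq_bigr => j _.
  by rewrite /g; case: eqP => //= <-; rewrite lx.
rewrite negb_forall => /existsP[i]; rewrite negbK => xii.
by rewrite (bigD1 i)//= (bigD1 i)//= /g eqxx xii !mul0r.
Qed.

End FiniteTools.

(** * Labellings with many conflicts are unlikely *)

Section WrongLabels.
Context {R : realType} {Q n : nat}.
Implicit Types (x : 'M[bool]_n) (z : {ffun 'I_n -> 'I_Q}) (pi : 'M[R]_Q).

(** Hellinger affinity of two Bernoulli laws. *)
Definition affinity (p p' : R) :=
  Num.sqrt (p * p') + Num.sqrt ((1 - p) * (1 - p')).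

Lemma affinity_le1 p p' : 0 <= p <= 1 -> 0 <= p' <= 1 ->
  affinity p p' <= 1 /\ (p != p' -> affinity p p' < 1).
Proof.
move=> /andP[p0 p1] /andP[q0 q1]; rewrite /affinity !sqrtrM ?subr_ge0//.
have := sqr_sqrtr p0; have := sqr_sqrtr q0.
have /sqr_sqrtr : 0 <= 1 - p by rewrite subr_ge0.
have /sqr_sqrtr : 0 <= 1 - p' by rewrite subr_ge0.
set a := Num.sqrt p; set b := Num.sqrt p'.
set c := Num.sqrt (1 - p); set d := Num.sqrt (1 - p') => d2 c2 b2 a2.
have E : a * b + c * d = 1 - ((a - b) ^+ 2 + (c - d) ^+ 2) / 2. by lra.
have ab0 := sqr_ge0 (a - b); have cd0 := sqr_ge0 (c - d).
rewrite E; split; first by lra.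
move=> pp'; have : 0 < (a - b) ^+ 2; last by lra.
rewrite lt_neqAle ab0 andbT eq_sym sqrf_eq0 subr_eq0.
by apply: contra pp' => /eqP ab; rewrite -a2 -b2 ab.
Qed.

(** The entries of pi are finitely many, so distinct ones have affinities bounded
    away from 1. *)
Lemma affinity_gap pi : (forall q l, 0 <= pi q l <= 1) ->
  exists2 h, 0 < h & forall q l q' l', pi q l != pi q' l' ->
    affinity (pi q l) (pi q' l') <= expR (- h).
Proof.
move=> pi01.
have [] := @finite_gap R ('I_Q * 'I_Q * ('I_Q * 'I_Q))%type
  (fun u => pi u.1.1 u.1.2 != pi u.2.1 u.2.2)
  (fun u => 1 - affinity (pi u.1.1 u.1.2) (pi u.2.1 u.2.2)).
  by move=> u ne; rewrite subr_gt0; apply: (affinity_le1 _ _).2.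
move=> h h0 hh; exists h => // q l q' l' ne.
have /= := hh ((q, l), (q', l')) ne; have := expR_ge1Dx (- h); lra.
Qed.

(** Affinities multiply over independent edges, and each conflict contributes a
    factor at most exp (- h). *)
Lemma sum_sqrt_edge_lik pi z z' (h : R) : (forall q l, 0 <= pi q l <= 1) ->
  (forall q l q' l', pi q l != pi q' l' ->
    affinity (pi q l) (pi q' l') <= expR (- h)) ->
  \sum_(x : 'M[bool]_n | loopless x)
     Num.sqrt (edge_lik x z pi * edge_lik x z' pi) <=
  expR (- (h * (conflict pi z z')%:R)).
Proof.
move=> pi01 hh.
pose f i j b := Num.sqrt (bernoulli_pmf (pi (z i) (z j)) b *
                          bernoulli_pmf (pi (z' i) (z' j)) b).
have -> : \sum_(x : 'M[bool]_n | loopless x)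
     Num.sqrt (edge_lik x z pi * edge_lik x z' pi) =
   \sum_(x : 'M[bool]_n | loopless x)
     \prod_i \prod_(j | i != j) f i j (x i j).
  apply: eq_bigr => x _; rewrite /edge_lik -big_split/= sqrtr_prod.
    apply: eq_bigr => i _; rewrite -big_split/= sqrtr_prod// => j _.
    by rewrite mulr_ge0// bernoulli_pmf_ge0_in.
  move=> i _; rewrite -big_split/=; apply: prodr_ge0 => j _.
  by rewrite mulr_ge0// bernoulli_pmf_ge0_in.
rewrite sum_loopless_prod.
have -> : expR (- (h * (conflict pi z z')%:R)) =
  \prod_i \prod_(j | i != j)
    (if pi (z' i) (z' j) != pi (z i) (z j) then expR (- h) else 1).
  rewrite mulrC -mulrN expRM_natl /conflict -prodr_const.
  rewrite pair_big_dep/=.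
  rewrite [LHS]big_mkcond [RHS]big_mkcond/=; apply: eq_bigr => -[i j] _.
  by rewrite inE/=; case: (i != j).
apply: ler_prod => i _; rewrite prodr_ge0/=; last first.
  by move=> j _; rewrite addr_ge0 ?sqrtr_ge0.
apply: ler_prod => j _; rewrite addr_ge0 ?sqrtr_ge0//=.
case: ifPn => [ne|_]; first by apply: hh; rewrite eq_sym.
exact: (affinity_le1 (pi01 _ _) (pi01 _ _)).1.
Qed.

(** Where the likelihood of z' is at least exp (- 2 a) times that of z, the
    latter is at most exp a times the geometric mean of the two. No quotient of
    likelihoods is formed, so vanishing ones are harmless. *)
Lemma wrong_label_tail pi z z' (h a : R) : (forall q l, 0 <= pi q l <= 1) ->
  (forall q l q' l', pi q l != pi q' l' ->
    affinity (pi q l) (pi q' l') <= expR (- h)) ->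
  \sum_(x : 'M[bool]_n | loopless x &&
      (expR (- (2 * a)) * edge_lik x z pi <= edge_lik x z' pi))
    edge_lik x z pi <= expR (a - h * (conflict pi z z')%:R).
Proof.
move=> pi01 hh; rewrite expRD.
apply: le_trans (ler_wpM2l (expR_ge0 _) (sum_sqrt_edge_lik z z' pi01 hh)).
rewrite mulr_sumr big_mkcondr/=; apply: ler_sum => x _.
have w0 k : 0 <= edge_lik x k pi by exact: edge_lik_ge0.
case: ifP => [le|_]; last by rewrite mulr_ge0 ?expR_ge0 ?sqrtr_ge0.
rewrite -ler_pdivrMl ?expR_gt0// -expRN.
rewrite -[leLHS]ger0_norm ?mulr_ge0 ?expR_ge0// -sqrtr_sqr ler_wsqrtr//.
rewrite exprMn -expRM_natl mulrN expr2 mulrA mulrC ler_wpM2l//.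
Qed.

End WrongLabels.

(** * Concentration of the class sizes *)

Section ClassSizes.
Context {R : realType} {Q n : nat}.
Implicit Types (z : {ffun 'I_n -> 'I_Q}) (alpha : 'rV[R]_Q).

Lemma expR_le_quadratic (x : R) : x <= 1 / 2 -> expR x <= 1 + x + 2 * x ^+ 2.
Proof.
move=> x2; have ex := expR_ge1Dx (- x); rewrite expRN in ex.
have e0 := expR_gt0 x; have q0 := sqr_ge0 x.
have h : (1 - x) * expR x <= 1.
  by rewrite -ler_pdivlMr// div1r.
rewrite -(ler_pM2l (x := 1 - x)); last by lra.
apply: le_trans h _.
have -> : (1 - x) * (1 + x + 2 * x ^+ 2) = 1 + x ^+ 2 * (1 - 2 * x) by ring.
by rewrite lerDl mulr_ge0//; lra.
Qed.

(** Chernoff bound with t = eps / 4. The variables z i are independent with law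
    alpha, so the exponential moment of the sum is an n-th power. *)
Lemma centered_tail alpha (u : 'I_Q -> R) (eps : R) :
  0 <= eps <= 2 -> (forall q, 0 <= alpha 0 q) -> \sum_q alpha 0 q = 1 ->
  (forall q, `|u q| <= 1) -> \sum_q alpha 0 q * u q = 0 ->
  \sum_(z : {ffun 'I_n -> 'I_Q} | eps * n%:R < \sum_i u (z i))
    label_lik alpha z <= expR (- (eps ^+ 2 / 8 * n%:R)).
Proof.
move=> /andP[e0 e2] a0 sa u1 su; pose t := eps / 4.
have step : \sum_q alpha 0 q * expR (t * u q) <= expR (2 * t ^+ 2).
  apply: le_trans (expR_ge1Dx _).
  apply: (@le_trans _ _ (\sum_q (alpha 0 q + t * (alpha 0 q * u q) +
     2 * t ^+ 2 * alpha 0 q))).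
    apply: ler_sum => q _; have := u1 q; rewrite ler_norml => /andP[l1 l2].
    have u2 : u q ^+ 2 <= 1 by rewrite -[leLHS]real_normK ?num_real// expr_le1.
    have -> : alpha 0 q + t * (alpha 0 q * u q) + 2 * t ^+ 2 * alpha 0 q =
      alpha 0 q * (1 + t * u q + 2 * t ^+ 2) by ring.
    apply: ler_wpM2l => //; apply: le_trans (expR_le_quadratic _) _.
      by rewrite /t; nra.
    by rewrite lerD2l exprMn ler_wpM2l// ler_piMr// sqr_ge0.
  by rewrite !big_split/= -!mulr_sumr su sa mulr0 addr0 mulr1.
apply: (@le_trans _ _ (\sum_(z : {ffun 'I_n -> 'I_Q})
    expR (- (t * (eps * n%:R))) * \prod_i (alpha 0 (z i) * expR (t * u (z i))))).
  rewrite big_mkcond/=; apply: ler_sum => z _; case: ifP => [hz|_]; last first.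
    rewrite mulr_ge0 ?expR_ge0//; apply: prodr_ge0 => i _.
    by rewrite mulr_ge0 ?expR_ge0.
  rewrite big_split/= -expR_sum mulrCA -expRD -/(label_lik alpha z).
  rewrite ler_peMr ?label_lik_ge0// -[leLHS]expR0 ler_expR addrC subr_ge0.
  rewrite -mulr_sumr; apply: ler_wpM2l; first by rewrite divr_ge0.
  exact: ltW.
rewrite -mulr_sumr.
rewrite -(bigA_distr_bigA (fun (i : 'I_n) q => alpha 0 q * expR (t * u q))).
rewrite prodr_const card_ord.
apply: (@le_trans _ _ (expR (- (t * (eps * n%:R))) * expR (2 * t ^+ 2) ^+ n)).
  rewrite ler_wpM2l ?expR_ge0// lerXn2r ?nnegrE ?expR_ge0//.
  by apply: sumr_ge0 => q _; rewrite mulr_ge0 ?expR_ge0.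
rewrite -expRM_natl -expRD ler_expR /t le_eqVlt; apply/orP; left; apply/eqP.
by field.
Qed.

Lemma class_size_tail alpha q (eps : R) :
  0 <= eps <= 2 -> (forall q, 0 <= alpha 0 q <= 1) -> \sum_q alpha 0 q = 1 ->
  \sum_(z : {ffun 'I_n -> 'I_Q} |
      eps * n%:R < `|(class_size z q)%:R - n%:R * alpha 0 q|)
    label_lik alpha z <= 2 * expR (- (eps ^+ 2 / 8 * n%:R)).
Proof.
move=> he a01 sa; pose u k := (k == q)%:R - alpha 0 q.
have a0 k : 0 <= alpha 0 k by have /andP[] := a01 k.
have u1 k : `|u k| <= 1.
  have := a01 q; rewrite /u ler_norml; case: (k == q) => /= /andP[? ?];
  by apply/andP; split; lra.
have su : \sum_k alpha 0 k * u k = 0.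
  rewrite /u; under eq_bigr do rewrite mulrBr.
  rewrite sumrB -mulr_suml sa mul1r (bigD1 q)//= eqxx mulr1 big1 ?addr0 ?subrr//.
  by move=> k /negPf ->; rewrite mulr0.
have NE z : (class_size z q)%:R - n%:R * alpha 0 q = \sum_i u (z i).
  rewrite /u sumrB sumr_const card_ord mulr_natl; congr (_ - _).
  rewrite /class_size -sum1_card natr_sum big_mkcond/=.
  by apply: eq_bigr => i _; rewrite inE; case: eqP.
have t1 := @centered_tail alpha u eps he a0 sa u1 su.
have t2 : \sum_(z : {ffun 'I_n -> 'I_Q} | eps * n%:R < \sum_i - u (z i))
    label_lik alpha z <= expR (- (eps ^+ 2 / 8 * n%:R)).
  apply: (@centered_tail alpha (fun k => - u k)) => //.
  - by move=> k; rewrite normrN.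
  - by under eq_bigr do rewrite mulrN; rewrite sumrN su oppr0.
rewrite mulr2n mulrDl mul1r; apply: le_trans (lerD t1 t2).
rewrite big_mkcond [X in _ <= X + _]big_mkcond [X in _ <= _ + X]big_mkcond.
rewrite -big_split/=; apply: ler_sum => z _; rewrite NE sumrN ltr_normr.
have := label_lik_ge0 z a0.
by case: (_ < \sum_i u (z i)); case: (_ < - \sum_i u (z i)) => /=; lra.
Qed.

End ClassSizes.

(** * Typical configurations *)

Section Typical.
Context {R : realType} {Q n : nat}.
Implicit Types (x : 'M[bool]_n) (z : {ffun 'I_n -> 'I_Q}).
Implicit Types (alpha : 'rV[R]_Q) (pi : 'M[R]_Q).

(** The event on which the deterministic part of the argument runs: class sizes
    near their means, and no labelling with many conflicts has a likelihood
    comparable with that of the true one. *)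
Definition typical alpha pi (eps kappa a : R) z x : bool :=
  [&& [forall q,
         `|(class_size z q)%:R - n%:R * alpha 0 q| <= eps * n%:R],
      0 < edge_lik x z pi
    & [forall z', (kappa <= (conflict pi z z')%:R) ==>
         (edge_lik x z' pi < expR (- (2 * a)) * edge_lik x z pi)]].

Lemma sum_edge_lik pi z : \sum_(x : 'M[bool]_n | loopless x) edge_lik x z pi = 1.
Proof.
rewrite (sum_loopless_prod (fun i j b => bernoulli_pmf (pi (z i) (z j)) b)).
by rewrite big1// => i _; rewrite big1// => j _; rewrite /bernoulli_pmf addrC subrK.
Qed.

(** Union bound over the Q classes and the Q ^ n labellings. The event that the
    true labelling has likelihood 0 contributes nothing to the sum. *)
Lemma atypical_mass alpha pi (eps kappa a h : R) :
  0 <= eps <= 2 -> 0 <= h -> sbm_param alpha pi ->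
  (forall q l q' l', pi q l != pi q' l' ->
    affinity (pi q l) (pi q' l') <= expR (- h)) ->
  \sum_(z : {ffun 'I_n -> 'I_Q})
     \sum_(x | loopless x && ~~ typical alpha pi eps kappa a z x)
       label_lik alpha z * edge_lik x z pi <=
  Q%:R * (2 * expR (- (eps ^+ 2 / 8 * n%:R))) +
  Q%:R ^+ n * expR (a - h * kappa).
Proof.
move=> he h0 [a01 sa pi01] hh.
have a01' q : 0 <= alpha 0 q <= 1.
  by have /andP[/ltW-> /ltW] := a01 q.
have a0 q : 0 <= alpha 0 q by have /andP[] := a01' q.
have l0 z := @label_lik_ge0 R Q n alpha z a0.
have w0 x z := @edge_lik_ge0 R Q n x z pi pi01.
pose b1 q z := eps * n%:R < `|(class_size z q)%:R - n%:R * alpha 0 q|.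
pose b3 z z' x := (kappa <= (conflict pi z z')%:R) &&
   (expR (- (2 * a)) * edge_lik x z pi <= edge_lik x z' pi).
apply: (@le_trans _ _ (\sum_(z : {ffun 'I_n -> 'I_Q})
   \sum_(x : 'M[bool]_n | loopless x)
    (\sum_q (if b1 q z then label_lik alpha z * edge_lik x z pi else 0) +
     \sum_z' (if b3 z z' x then label_lik alpha z * edge_lik x z pi else 0)))).
  apply: ler_sum => z _; rewrite big_mkcondr/=; apply: ler_sum => x _.
  have t0 : 0 <= label_lik alpha z * edge_lik x z pi by rewrite mulr_ge0.
  have s1 : 0 <= \sum_q (if b1 q z then label_lik alpha z * edge_lik x z pi else 0).
    by apply: sumr_ge0 => q _; case: ifP.
  have s3 : 0 <= \sum_z' (if b3 z z' x then label_lik alpha z * edge_lik x z pi else 0).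
    by apply: sumr_ge0 => q _; case: ifP.
  case: ifPn => [|_]; last by rewrite addr_ge0.
  rewrite /typical !negb_and => /or3P[|wz|].
  - rewrite negb_forall => /existsP[q]; rewrite -ltNge => bq.
    rewrite ler_wpDr// (bigD1 q)//= /b1 bq ler_wpDr//.
    by apply: sumr_ge0 => k _; case: ifP.
  - have -> : edge_lik x z pi = 0.
      by apply/eqP; rewrite eq_le w0 andbT leNgt.
    rewrite mulr0 addr_ge0//; apply: sumr_ge0 => k _; by case: ifP.
  - rewrite negb_forall => /existsP[z']; rewrite negb_imply -leNgt => bz.
    rewrite ler_wpDl// (bigD1 z')//= /b3 bz ler_wpDr//.
    by apply: sumr_ge0 => k _; case: ifP.
under eq_bigr do rewrite big_split/=.
rewrite big_split/=; apply: lerD.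
  under eq_bigr do rewrite exchange_big/=.
  rewrite exchange_big/= mulr_natl -[X in _ *+ X]card_ord -sumr_const.
  apply: ler_sum => q _; apply: le_trans (class_size_tail q he a01' sa).
  rewrite [leRHS]big_mkcond; apply: ler_sum => z _; rewrite -/(b1 q z).
  case: ifP => _; last by rewrite big1.
  by rewrite -mulr_sumr sum_edge_lik mulr1.
under eq_bigr do rewrite exchange_big/=.
apply: (@le_trans _ _ (\sum_(z : {ffun 'I_n -> 'I_Q})
   label_lik alpha z * (Q%:R ^+ n * expR (a - h * kappa)))); last first.
  by rewrite -mulr_suml sum_label_lik sa expr1n mul1r.
apply: ler_sum => z _.
have -> : Q%:R ^+ n * expR (a - h * kappa) =
    \sum_(z' : {ffun 'I_n -> 'I_Q}) expR (a - h * kappa).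
  by rewrite sumr_const card_ffun !card_ord -[RHS]mulr_natl natrX.
rewrite mulr_sumr; apply: ler_sum => z' _; rewrite /b3.
have [kc|_]/= := boolP (kappa <= _); last first.
  by rewrite big1// mulr_ge0 ?expR_ge0.
rewrite -big_mkcondr/= -mulr_sumr ler_wpM2l//.
apply: le_trans (wrong_label_tail z z' a pi01 hh) _.
by rewrite ler_expR lerD2l lerN2 ler_wpM2l.
Qed.

End Typical.

(** * The finite-dimensional laws of the model *)

Section Law.
Context {R : realType} {Q : nat}.
Context {d : measure_display} {T : measurableType d} (P : probability T R).
Variables (Z : nat -> T -> 'I_Q) (X : nat -> nat -> T -> bool).
Variables (alpha : 'rV[R]_Q) (pi : 'M[R]_Q).
Hypothesis hsbm : is_sbm P Z X alpha pi.

Definition labels n (w : T) : {ffun 'I_n -> 'I_Q} := [ffun i => Z (val i) w].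

Definition configuration n (z : {ffun 'I_n -> 'I_Q}) (x : 'M[bool]_n) : set T :=
  [set w | labels n w = z /\ adjacency X n w = x].

Lemma measurable_configuration n (z : {ffun 'I_n -> 'I_Q}) x :
  measurable (configuration z x).
Proof.
have -> : configuration z x =
    (\bigcap_(i in [set: 'I_n]) [set w | Z i w = z i]) `&`
    (\bigcap_(p in [set: 'I_n * 'I_n]) (X p.1 p.2 @^-1` [set x p.1 p.2])).
  apply/seteqP; split => w /=.
    move=> [<- <-]; split=> [i _|p _] /=; first by rewrite ffunE.
    by rewrite mxE.
  move=> [hz hx]; split; first by apply/ffunP => i; rewrite ffunE; apply: hz.
  by apply/matrixP => i j; rewrite mxE; apply: (hx (i, j)).
apply: measurableI; apply: fin_bigcap_measurable => //.
- by move=> i _; exact: (sbm_measurable_label hsbm).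
- move=> p _; rewrite -[X in measurable X]setTI.
  exact: (sbm_measurable_edge hsbm).
Qed.

Lemma measurable_finite_event n
    (B : {ffun 'I_n -> 'I_Q} -> 'M[bool]_n -> Prop) :
  measurable [set w | B (labels n w) (adjacency X n w)].
Proof.
have -> : [set w | B (labels n w) (adjacency X n w)] =
    \bigcup_(p in [set p | B p.1 p.2]) configuration p.1 p.2.
  apply/seteqP; split => w /=.
    by move=> b; exists (labels n w, adjacency X n w).
  by move=> [[z x]/= b [-> ->]].
apply: fin_bigcup_measurable; first exact: finite_finset.
by move=> p _; exact: measurable_configuration.
Qed.

(** The law of the model fixes only the off-diagonal entries; the diagonal is
    false by assumption, hence the restriction to loopless matrices. *)
Lemma prob_configuration n (z : {ffun 'I_n -> 'I_Q}) (x : 'M[bool]_n) :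
  P (configuration z x) =
  (if loopless x then label_lik alpha z * edge_lik x z pi else 0)%:E.
Proof.
case: ifPn => [/forallP lx|].
  have -> : configuration z x = labels_are Z z `&` edges_are X x.
    apply/seteqP; split => w /=.
      move=> [<- <-]; split=> [i|i j _]; first by rewrite ffunE.
      by rewrite mxE.
    move=> [hz hx]; split; first by apply/ffunP => i; rewrite ffunE hz.
    apply/matrixP => i j; rewrite mxE; have [<-|ij] := eqVneq i j.
      by rewrite (sbm_no_loop hsbm) (negbTE (lx i)).
    exact: hx.
  rewrite (sbm_edge_law hsbm) (sbm_label_indep hsbm) EFinM; congr (_ * _)%E.
  rewrite /label_lik (big_morph EFin (@EFinM R) erefl).
  by apply: eq_bigr => i _; rewrite (sbm_label_law hsbm).
rewrite negb_forall => /existsP[i]; rewrite negbK => xii.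
rewrite (_ : configuration z x = set0) ?measure0//.
apply/seteqP; split => // w [_ ax].
by move: xii; rewrite -ax mxE (sbm_no_loop hsbm).
Qed.

Lemma prob_finite_event_le n (B : {ffun 'I_n -> 'I_Q} -> pred 'M[bool]_n) :
  (P [set w | B (labels n w) (adjacency X n w)] <=
   (\sum_z \sum_(x | loopless x && B z x)
      label_lik alpha z * edge_lik x z pi)%:E)%E.
Proof.
rewrite pair_big_dep/=.
have -> : [set w | B (labels n w) (adjacency X n w)] =
    \big[setU/set0]_(p : {ffun 'I_n -> 'I_Q} * 'M[bool]_n | B p.1 p.2)
       configuration p.1 p.2.
  apply/seteqP; split => w /=.
    move=> b; rewrite (bigD1 (labels n w, adjacency X n w))//=.
    by left.
  rewrite -bigcup_seq_cond => -[[z x]/= /andP[_ b] [-> ->]].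
  exact: b.
under eq_bigl do rewrite andbC; rewrite big_mkcondr/=.
apply: (proj2 (_ : measurable _ /\ _)).
apply: (@big_rec2 _ _ (fun A y => measurable A /\ (P A <= y%:E)%E)).
  by rewrite measure0.
move=> p A y _ [mA yA]; have mC := measurable_configuration p.1 p.2.
split; first exact: measurableU.
apply: le_trans (measureU2 _ _ _) _ => //.
by rewrite EFinD -prob_configuration; exact: leeD.
Qed.

End Law.

(** * Closeness of the maximum-likelihood proportions for a typical graph *)

Section MleClose.
Context {R : realType} {Q n : nat}.

(** Used with g = gamma, to compare powers of gamma with exponentials. *)
Lemma expR_Ninv_le (g : R) : 0 < g -> expR (- g^-1) <= g.
Proof.
move=> g0; rewrite expRN -[leRHS]invrK lef_pV2 ?posrE ?invr_gt0 ?expR_gt0//.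
by apply: le_trans (expR_ge1Dx _); rewrite lerDr.
Qed.

(** Conjunction of the preceding parts for one graph. A labelling that is not
    aligned with zs has many conflicts by exists_alignment, hence a negligible
    likelihood under pis, and also under pih since passing from one parameter to
    the other costs a factor exp (eta / zeta * n ^ 2) each way. *)
Lemma mle_close (zeta gamma eta t eps kappa a : R) (x : 'M[bool]_n) zs
    (alphas : 'rV[R]_Q) pis alphah pih :
  (0 < n)%N -> 0 < zeta -> 0 < gamma -> eta < zeta -> eta < 1 ->
  0 <= t -> 0 <= eps -> eps + Q%:R * t <= gamma ->
  kappa + n%:R <= (t * n%:R) ^+ 2 ->
  2 * expR (2 * (eta / zeta * n%:R ^+ 2) - 2 * a) <= gamma ^+ n ->
  admissible zeta gamma alphas pis -> is_mle zeta gamma x alphah pih ->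
  `|pih - pis| <= eta -> typical alphas pis eps kappa a zs x ->
  exists2 s, s \in stab_pi pis & forall q,
    (alphah 0 (s q) - alphas 0 q) ^+ 2 <=
    8 * (gamma^-1 * Q%:R ^+ 2 * t + #|stab_pi pis|%:R / n%:R +
         eps * Q%:R * (gamma^-1 + 1)).
Proof.
move=> n0 z0 g0 ez e1 t0 ep0 hgt hkappa hsmall adm mle hd.
move=> /and3P[/forallP hN wzs /forallP hz'].
have [[_ sas ps01] a1s a2s a3s] := adm.
have admh := mle.1; have [[_ sah ph01] _ a2h a3h] := admh.
have nR : (0 : R) < n%:R by rewrite ltr0n.
pose delta := Q%:R ^+ 2 * (t * n%:R).
pose E := expR (- (2 * (gamma^-1 * delta))).
have pert1 z := edge_lik_perturb x z z0 ez e1 ps01 ph01 a2s a2h hd.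
rewrite distrC in hd.
have pert2 z := edge_lik_perturb x z z0 ez e1 ph01 ps01 a2h a2s hd.
have [] := @mle_label_ratio R Q n zeta gamma delta E x zs alphas pis alphah pih.
- exact: g0.
- exact: expR_gt0.
- move=> h hh; rewrite -exprM.
  apply: (@le_trans _ _ (expR (- gamma^-1) ^+ (2 * h))).
    rewrite -expRM_natl ler_expR mulrN lerN2 natrM mulrAC -mulrA.
    by rewrite ler_pM2l// ler_wpM2l// invr_ge0 ltW.
  by rewrite lerXn2r ?nnegrE ?expR_ge0 ?(ltW g0)// expR_Ninv_le.
- exact: adm.
- exact: mle.
- have := lt_le_trans wzs (pert2 zs).
  by rewrite pmulr_rgt0// expR_gt0.
- move=> z far.
  have kc : kappa <= (conflict pis zs z)%:R.
    rewrite leNgt; apply/negP => kc.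
    have sizes q : Q%:R * (t * n%:R) <= (class_size zs q)%:R.
      have := hN q; rewrite ler_norml => /andP[hN1 _].
      have /andP[ga _] := a3s q; rewrite -subr_ge0.
      apply: (@le_trans _ _ (n%:R * (alphas 0 q - eps - Q%:R * t))).
        by rewrite mulr_ge0//; lra.
      by move: hN1; rewrite mulrA; lra.
    have few : (conflict pis zs z)%:R + n%:R < (t * n%:R) ^+ 2.
      by apply: lt_le_trans hkappa; rewrite ltrD2r.
    have [s sS] := exists_alignment a1s t0 sizes few.
    by rewrite leNgt far.
  have lt := implyP (hz' z) kc.
  apply: (@le_trans _ _ (2 * (expR (eta / zeta * n%:R ^+ 2) *
     (expR (- (2 * a)) * (expR (eta / zeta * n%:R ^+ 2) * edge_lik x zs pih))))).
    rewrite ler_wpM2l//; apply: le_trans (pert1 z) _.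
    rewrite ler_wpM2l ?expR_ge0//; apply: le_trans (ltW lt) _.
    by rewrite ler_wpM2l ?expR_ge0.
  rewrite (_ : 2 * _ = 2 * expR (2 * (eta / zeta * n%:R ^+ 2) - 2 * a) * edge_lik x zs pih).
    by rewrite ler_wpM2r ?edge_lik_ge0.
  rewrite expRD (_ : 2 * (eta / zeta * n%:R ^+ 2) =
    eta / zeta * n%:R ^+ 2 + eta / zeta * n%:R ^+ 2); last by rewrite mulr2n mulrDl mul1r.
  by rewrite expRD; ring.
move=> s sS hs; exists s => // q.
have S1 : (1 : R) <= #|stab_pi pis|%:R.
  by rewrite ler1n; apply/card_gt0P; exists s.
have hal k : gamma <= alphas 0 k <= 1.
  by have /andP[-> _] := a3s k; have [[h _ _] _ _ _] := adm; have /andP[_ /ltW] := h k.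
have hah k : gamma <= alphah 0 k <= 1.
  by have /andP[-> _] := a3h k; have [[h _ _] _ _ _] := admh; have /andP[_ /ltW] := h k.
have := @label_ratio_close R Q n gamma eps (gamma^-1 * delta + #|stab_pi pis|%:R)
  zs (fun q => alphas 0 q) (fun q => alphah 0 (s q)) n0 g0 ep0 hal _ sas _ hN.
have -> : (gamma^-1 * delta + #|stab_pi pis|%:R) / n%:R =
   gamma^-1 * Q%:R ^+ 2 * t + #|stab_pi pis|%:R / n%:R.
  by rewrite /delta; field; rewrite !lt0r_neq0.
apply.
- by [].
- by rewrite -sah [RHS](reindex_perm s).
- rewrite mulrDr opprD expRD -/E expRN mulrAC.
  rewrite ler_pdivrMr ?expR_gt0//.
  rewrite -[\prod_(i < n) alphas 0 (zs i)]/(label_lik alphas zs).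
  have -> : \prod_(i < n) alphah 0 (s (zs i)) = label_lik alphah [ffun i => s (zs i)].
    by apply: eq_bigr => i _; rewrite ffunE.
  apply: le_trans hs _; rewrite mulrC ler_wpM2l//.
    by apply: label_lik_ge0 => k; have /andP[h _] := hah k; apply: le_trans h; exact: ltW.
  by apply: le_trans (expR_ge1Dx _); rewrite lerDr.
Qed.

End MleClose.

(** * Measurability of the events *)

Section OpenMeasurable.
Context {R : realType} {d : measure_display} {T : measurableType d}.

(** An open set of matrices is a countable union of balls with rational centres
    and radii 1 / (k + 1), and a ball is a box. *)
Lemma measurable_preimage_open_mx (m n : nat) (f : T -> 'M[R]_(m, n))
    (U : set 'M[R]_(m, n)) :
  (forall i j, measurable_fun [set: T] (fun w => f w i j)) ->
  open U -> measurable (f @^-1` U).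
Proof.
move=> mf oU.
pose box (p : 'M[rat]_(m, n) * nat) : set 'M[R]_(m, n) :=
  ball (map_mx ratr p.1 : 'M[R]_(m, n)) p.2.+1%:R^-1.
have mbox p : measurable (f @^-1` box p).
  have -> : f @^-1` box p = \bigcap_(ij in [set: 'I_m * 'I_n])
      ((fun w => f w ij.1 ij.2) @^-1`
        ball (map_mx ratr p.1 ij.1 ij.2 : R) p.2.+1%:R^-1).
    apply/seteqP; split => w /=; first by move=> [_ h] ij _; exact: h.
    by move=> h; split; [rewrite invr_gt0 | move=> i j; apply: (h (i, j))].
  apply: fin_bigcap_measurable => // ij _; rewrite -[X in measurable X]setTI.
  by apply: mf => //; exact: measurable_realfun.measurable_ball.
have -> : f @^-1` U = \bigcup_p (if `[< box p `<=` U >] then f @^-1` box p else set0).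
  apply/seteqP; split => w /=; last first.
    by move=> [p _]; case: asboolP => // bU; exact: bU.
  move=> Uw; have /nbhs_ballP[e /= e0 eU] : nbhs (f w) U by exact: open_nbhs_nbhs.
  have [k ke] : exists k : nat, k.+1%:R^-1 < e / 2.
    have [k _ /(_ k)/= h] := near_infty_natSinv_lt (PosNum (divr_gt0 e0 (ltr0n R 2))).
    by exists k; apply: h.
  have k0 : (0 : R) < k.+1%:R^-1 by rewrite invr_gt0.
  move: ke k0; set r := (k.+1%:R^-1 : R) => rlt r0.
  have /fin_all_exists[c hc] : forall ij : 'I_m * 'I_n, exists c : rat,
      ball (ratr c : R) r (f w ij.1 ij.2).
    move=> ij; have [c] : exists c : rat,
      ratr c \in `]f w ij.1 ij.2 - r, f w ij.1 ij.2 + r[.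
      by apply: rat_in_itvoo; lra.
    rewrite in_itv/= => /andP[c1 c2]; exists c.
    by rewrite /ball/= ltr_norml; apply/andP; split; lra.
  pose C : 'M[rat]_(m, n) := \matrix_(i, j) c (i, j).
  have bw : box (C, k) (f w) by split=> // i j; rewrite !mxE; exact: hc (i, j).
  exists (C, k) => //; case: asboolP => // nU; case: nU => v bv.
  apply: eU; apply: (@le_ball _ _ _ (r + r)); first by lra.
  by apply: ball_triangle bv; exact: ball_sym.
apply: countable_bigcupT_measurable => // p.
by case: asboolP.
Qed.

End OpenMeasurable.

Section UsualDistance.
Context {R : realType} {Q : nat}.
Variable d0 : 'rV[R]_Q -> 'rV[R]_Q -> R.
Hypothesis hd0 : usual_distance d0.

Lemma usual_distance_ge0 u v : 0 <= d0 u v.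
Proof.
have [d00 dC dD _] := hd0.
have := dD u v u; rewrite (dC v u) (proj2 (d00 u u) erefl); lra.
Qed.

Lemma usual_distance_small (a : 'rV[R]_Q) (eps : R) : 0 < eps ->
  exists2 eta, 0 < eta &
    forall u : 'rV[R]_Q, (forall q, `|u 0 q - a 0 q| < eta) -> d0 u a < eps.
Proof.
move=> e0; have [_ dC _ dN] := hd0.
have : nbhs a [set v | d0 a v < eps] by apply/dN; exists eps.
move=> /nbhs_ballP[eta /= eta0 h]; exists eta => // u hu.
rewrite dC; apply: h; split=> // i q; rewrite [i]ord1.
by rewrite /ball/= distrC.
Qed.

(** By the triangle inequality the complement of a closed d0-ball contains a
    d0-ball around each of its points. *)
Lemma open_usual_distance_gt (a : 'rV[R]_Q) (eps : R) : open [set u | eps < d0 u a].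
Proof.
have [_ dC dD dN] := hd0.
rewrite openE => u /= hu; apply/dN.
exists (d0 u a - eps); first by rewrite subr_gt0.
by move=> v /= huv; have := dD u v a; lra.
Qed.

Lemma dist_switch_ge0 pi u v : 0 <= dist_switch d0 pi u v.
Proof.
apply: le_bigmin => [|s _]; exact: usual_distance_ge0.
Qed.

Lemma dist_switch_le pi s u v : s \in stab_pi pi ->
  dist_switch d0 pi u v <= d0 (relabel_alpha s u) v.
Proof. by move=> sS; exact: bigmin_le_cond. Qed.

Lemma measurable_dist_switch_gt {d : measure_display} {T : measurableType d}
    (f : T -> 'rV[R]_Q) pi a (eps : R) :
  (forall q, measurable_fun [set: T] (fun w => f w 0 q)) ->
  measurable [set w | eps < `|dist_switch d0 pi (f w) a - 0|].
Proof.
move=> mf.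
have -> : [set w | eps < `|dist_switch d0 pi (f w) a - 0|] =
    (f @^-1` [set u | eps < d0 u a]) `&`
    \bigcap_(s in [set s | s \in stab_pi pi])
      ((fun w => relabel_alpha s (f w)) @^-1` [set u | eps < d0 u a]).
  apply/seteqP; split=> w /=; rewrite subr0 ger0_norm ?dist_switch_ge0//.
    by move=> /bigmin_gtP[? h]; split=> // s sS; exact: h.
  by move=> [? h]; apply/bigmin_gtP; split=> // s sS; exact: (h s).
apply: measurableI.
  apply: (@measurable_preimage_open_mx R d T _ _ f).
    by move=> i j; rewrite [i]ord1; exact: mf.
  exact: open_usual_distance_gt.
apply: fin_bigcap_measurable; first exact: finite_finset.
move=> s _.
apply: (@measurable_preimage_open_mx R d T _ _ (fun w => relabel_alpha s (f w))).
  move=> i j; rewrite [i]ord1 [X in measurable_fun _ X](_ : _ = fun w => f w 0 (s j)).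
    exact: mf.
  by apply/funext => w; rewrite mxE.
exact: open_usual_distance_gt.
Qed.

End UsualDistance.

Lemma measurable_mx_dist_gt {R : realType} {Q : nat} {d : measure_display}
    {T : measurableType d} (f : T -> 'M[R]_Q) (pi : 'M[R]_Q) (r : R) :
  (forall q l, measurable_fun [set: T] (fun w => f w q l)) ->
  measurable [set w | 1 < `| `|f w - pi| / r - 0|].
Proof.
move=> mf; pose g (v : 'M[R]_Q) := `| `|v - pi| / r - 0|.
apply: (@measurable_preimage_open_mx R d T _ _ f [set v | 1 < g v]) => //.
apply: (@open_comp _ _ g [set y | 1 < y]); last exact: open_gt.
move=> v _.
have c1 : (u - pi) @[u --> v] --> v - pi.
  exact: (@cvgB R 'M[R]_Q _ (nbhs v) _ id (fun=> pi) v pi cvg_id (cvg_cst pi)).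
have c2 : `|u - pi| @[u --> v] --> `|v - pi| by exact: cvg_norm c1.
have c3 : (`|u - pi| / r) @[u --> v] --> `|v - pi| / r.
  exact: cvgM c2 (cvg_cst _).
have c4 : (`|u - pi| / r - 0) @[u --> v] --> `|v - pi| / r - 0.
  exact: cvgB c3 (cvg_cst _).
exact: cvg_norm c4.
Qed.

Lemma sqrt_ln_rate {R : realType} (eta : R) : 0 < eta ->
  \forall n \near \oo, 0 < Num.sqrt (ln (n%:R : R)) / n%:R <= eta.
Proof.
move=> e0; near=> n.
have n2 : (2 <= n)%N by near: n; exact: nbhs_infty_ge.
have nR : (0 : R) < n%:R by rewrite ltr0n (leq_trans _ n2).
have hn : eta ^- 2 <= n%:R by near: n; exact: nbhs_infty_ger.
rewrite divr_gt0 ?sqrtr_gt0 ?ln_gt0 ?ltr1n//= ler_pdivrMr//.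
rewrite -[leRHS]ger0_norm ?mulr_ge0 ?(ltW e0)// -sqrtr_sqr ler_wsqrtr//.
(* ln n <= n <= (eta n) ^ 2 as soon as n >= eta ^ - 2. *)
apply: (@le_trans _ _ n%:R); first exact/ltW/ln_sublinear.
rewrite exprMn expr2 [n%:R ^+ 2]expr2 mulrA ler_peMl// mulrC -expr2.
by rewrite -ler_pdivrMr ?exprn_gt0// div1r.
Unshelve. all: by end_near. Qed.

(** * Asymptotics and convergence in probability *)

Section Asymptotics.
Context {R : realType}.

(** The level is half of (t n) ^ 2: exists_alignment requires fewer than
    (t n) ^ 2 - n conflicts, and n <= (t n) ^ 2 / 2 for large n. *)
Definition conflict_level (t : R) (n : nat) : R := (t * n%:R) ^+ 2 / 2.

(** Half of the exponent h * conflict_level earned by the conflicts: the other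
    half absorbs the Q ^ n labellings of the union bound. *)
Definition ratio_level (h t : R) (n : nat) : R := h * conflict_level t n / 2.

(** Choice of the constants. One parameter t serves as the tolerance on the class
    sizes and as the size of a large cell; eta is small enough for the error
    exp (2 eta / zeta * n ^ 2) to be beaten by the exponent 2 * ratio_level. *)
Lemma mle_close_eventually {Q} (zeta gamma h eta0 : R) (alphas : 'rV[R]_Q) pis :
  0 < zeta -> 0 < gamma -> 0 < h -> 0 < eta0 ->
  admissible zeta gamma alphas pis ->
  exists t eta : R, [/\ 0 < t <= 1, 0 < eta &
    \forall n \near \oo, forall (x : 'M[bool]_n) zs alphah pih,
      is_mle zeta gamma x alphah pih -> `|pih - pis| <= eta ->
      typical alphas pis t (conflict_level t n) (ratio_level h t n) zs x ->
      exists2 s, s \in stab_pi pis &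
        forall q, `|alphah 0 (s q) - alphas 0 q| < eta0].
Proof.
move=> z0 g0 h0 eta00 adm.
have gi0 : 0 < gamma^-1 by rewrite invr_gt0.
pose tau := eta0 ^+ 2 / 32.
have tau0 : 0 < tau by rewrite divr_gt0// exprn_gt0.
(* For any t with M t <= m / 2, the terms of the error in mle_close that are linear
   in t are at most m / 2, and so are Q t and t. *)
pose M := gamma^-1 * Q%:R ^+ 2 + Q%:R + Q%:R * (gamma^-1 + 1) + 1.
have Q0 : 0 <= Q%:R :> R by [].
have M1 : 1 <= M.
  rewrite /M lerDr !addr_ge0 ?mulr_ge0 ?exprn_ge0 ?addr_ge0//; exact: ltW.
pose m := Num.min tau (Num.min (gamma / 2) 1).
have m0 : 0 < m by rewrite !lt_min tau0 divr_gt0/=.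
have [m1 m2 m3] : [/\ m <= tau, m <= gamma / 2 & m <= 1].
  by split; rewrite /m !ge_min lexx ?orbT.
have [t t0 tM] : exists2 t, 0 < t & M * t = m / 2.
  exists (m / (2 * M)); first by rewrite divr_gt0// mulr_gt0//; lra.
  by field; rewrite lt0r_neq0//; lra.
pose A := gamma^-1 * Q%:R ^+ 2 * t; pose B := Q%:R * t.
pose C := t * Q%:R * (gamma^-1 + 1).
have t0' := ltW t0; have gi0' := ltW gi0.
have A0 : 0 <= A by rewrite /A !mulr_ge0 ?exprn_ge0.
have B0 : 0 <= B by rewrite /B mulr_ge0.
have C0 : 0 <= C by rewrite /C !mulr_ge0 ?addr_ge0.
have sumABC : A + B + C + t = m / 2 by rewrite -tM /A /B /C /M; ring.
pose eta := Num.min (zeta * (h * t ^+ 2) / 8) (Num.min (zeta / 2) (1 / 2)).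
have ht0 : 0 < h * t ^+ 2 by rewrite mulr_gt0// exprn_gt0.
have e0 : 0 < eta by rewrite !lt_min !divr_gt0// mulr_gt0.
have [e1 e2 e3] : [/\ eta <= zeta * (h * t ^+ 2) / 8, eta <= zeta / 2 & eta <= 1 / 2].
  by split; rewrite /eta !ge_min lexx ?orbT.
have t1 : t <= 1 by lra.
exists t, eta; split; [by rewrite t0 t1 | exact: e0 |].
near=> n => x zs alphah pih mle hd typ.
have n0 : (0 < n)%N by near: n; exact: nbhs_infty_gt.
have nR : (1 : R) <= n%:R by rewrite ler1n.
have n1 : 2 / t ^+ 2 <= n%:R by near: n; exact: nbhs_infty_ger.
have n2 : (gamma^-1 + 1) / (h * t ^+ 2 / 4) <= n%:R.
  by near: n; exact: nbhs_infty_ger.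
have n3 : #|stab_pi pis|%:R / tau <= n%:R by near: n; exact: nbhs_infty_ger.
have [|||||s sS hs] :=
  @mle_close R Q n zeta gamma eta t t (conflict_level t n) (ratio_level h t n)
    x zs alphas pis alphah pih n0 z0 g0 _ _ (ltW t0) (ltW t0) _ _ _ adm mle hd typ.
- by lra.
- by lra.
- by rewrite -/B; lra.
- rewrite ler_pdivrMr ?exprn_gt0// in n1.
  rewrite /conflict_level.
  have : 0 <= (n%:R * t ^+ 2 - 2) * n%:R by rewrite mulr_ge0// subr_ge0.
  by rewrite exprMn; move: (n%:R : R) => N; lra.
- have gn : expR (- (gamma^-1 * n%:R)) <= gamma ^+ n.
    rewrite mulrC -mulrN expRM_natl lerXn2r ?nnegrE ?expR_ge0 ?(ltW g0)//.
    exact: expR_Ninv_le.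
  apply: le_trans gn.
  (* The factor 2 is paid by expR 1 >= 2. *)
  have two : 2 <= expR (1 : R) by apply: le_trans (expR_ge1Dx _).
  apply: (@le_trans _ _ (expR 1 * expR (2 * (eta / zeta * n%:R ^+ 2) -
     2 * ratio_level h t n))); first by rewrite ler_wpM2r ?expR_ge0.
  rewrite -expRD ler_expR /ratio_level /conflict_level.
  have ez : eta / zeta <= h * t ^+ 2 / 8.
    by rewrite ler_pdivrMr// mulrC mulrA.
  rewrite ler_pdivrMr ?divr_gt0// in n2.
  have h1 : 0 <= (h * t ^+ 2 / 8 - eta / zeta) * n%:R ^+ 2.
    by rewrite mulr_ge0 ?subr_ge0 ?exprn_ge0.
  have h2 : 0 <= (n%:R * (h * t ^+ 2 / 4) - (gamma^-1 + 1)) * n%:R.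
    by rewrite mulr_ge0// subr_ge0.
  rewrite exprMn; move: nR h1 h2; move: (eta / zeta) (gamma^-1) (n%:R : R) => c g N.
  lra.
exists s => // q; have := hs q; rewrite -/A -/C => {}hs.
rewrite -(ltr_pXn2r (n := 2))// ?nnegrE ?(ltW eta00)// real_normK ?num_real//.
apply: le_lt_trans hs _.
have n3' : #|stab_pi pis|%:R / n%:R <= tau.
  rewrite ler_pdivrMr ?ltr0n// mulrC -ler_pdivrMr//.
have -> : eta0 ^+ 2 = 32 * tau by rewrite /tau; field.
lra.
Unshelve. all: by end_near. Qed.

Lemma atypical_mass_cvg0 (Q : nat) (t h : R) : 0 < t -> 0 < h ->
  (Q%:R * (2 * expR (- (t ^+ 2 / 8 * n%:R))) +
   Q%:R ^+ n * expR (ratio_level h t n - h * conflict_level t n))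
    @[n --> \oo] --> (0 : R).
Proof.
move=> t0 h0.
have geom (b : R) : 0 < b -> expR (- (b * n%:R)) @[n --> \oo] --> (0 : R).
  move=> b0; have : `|expR (- b)| < 1.
    by rewrite ger0_norm ?expR_ge0// -[ltRHS]expR0 ltr_expR oppr_lt0.
  move=> /cvg_expr; apply: cvg_trans; apply: near_eq_cvg; near=> n.
  by rewrite -expRM_natl mulrN mulrC.
rewrite -[X in _ --> X]addr0; apply: cvgD.
  rewrite -[X in _ --> X](mulr0 (Q%:R : R)); apply: cvgM; first exact: cvg_cst.
  rewrite -[X in _ --> X](mulr0 (2 : R)); apply: cvgM; first exact: cvg_cst.
  by apply: geom; rewrite divr_gt0// exprn_gt0.
have ht0 : 0 < h * t ^+ 2 by rewrite mulr_gt0// exprn_gt0.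
apply: (@squeeze_cvgr _ _ _ _ (fun=> 0) (fun n => expR (- (1 * n%:R)))).
- near=> n; rewrite mulr_ge0 ?exprn_ge0 ?expR_ge0//=.
  have n1 : (Q%:R + 1) / (h * t ^+ 2 / 4) <= n%:R.
    by near: n; exact: nbhs_infty_ger.
  apply: (@le_trans _ _ (expR Q%:R ^+ n *
      expR (ratio_level h t n - h * conflict_level t n))).
    rewrite ler_wpM2r ?expR_ge0// lerXn2r ?nnegrE ?expR_ge0//.
    by apply: le_trans (expR_ge1Dx _); rewrite lerDr.
  rewrite -expRM_natl -expRD ler_expR /ratio_level /conflict_level.
  rewrite ler_pdivrMr ?divr_gt0// in n1.
  have : 0 <= (n%:R * (h * t ^+ 2 / 4) - (Q%:R + 1)) * n%:R.
    by rewrite mulr_ge0// subr_ge0.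
  by rewrite exprMn; move: (n%:R : R) (Q%:R : R) => N q; lra.
- exact: cvg_cst.
- exact: geom.
Unshelve. all: by end_near. Qed.

End Asymptotics.

Unset Implicit Arguments.
Set Strict Implicit.
Set Printing Implicit Defensive.

Theorem theorem3p9 (R : realType) (Q : nat) (zeta gamma : R)
  (hzeta : 0 < zeta) (hgamma : 0 < gamma < 1 / Q%:R)
  (d : measure_display) (T : measurableType d) (P : probability T R)
  (* true parameter, labels and graph *)
  (alphas : 'rV[R]_Q) (pis : 'M[R]_Q)
  (htrue : admissible zeta gamma alphas pis)
  (Z : nat -> T -> 'I_Q) (X : nat -> nat -> T -> bool)
  (hsbm : is_sbm P Z X alphas pis)
  (* maximum-likelihood estimators *)
  (alphahat : nat -> T -> 'rV[R]_Q) (pihat : nat -> T -> 'M[R]_Q)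
  (malphahat : forall n q,
     measurable_fun [set: T] (fun w => alphahat n w 0 q))
  (mpihat : forall n q l,
     measurable_fun [set: T] (fun w => pihat n w q l))
  (hexists : P [set w | mle_exists (Q := Q) zeta gamma (adjacency X n w)]
     @[n --> \oo] --> 1%E)
  (hmle : forall n w,
     mle_exists (Q := Q) zeta gamma (adjacency X n w) ->
     is_mle zeta gamma (adjacency X n w) (alphahat n w) (pihat n w))
  (hrate : oP P (fun n w => `|pihat n w - pis|)
                (fun n => Num.sqrt (ln n%:R) / n%:R))
  (d0 : 'rV[R]_Q -> 'rV[R]_Q -> R) (hd0 : usual_distance d0) :
  cvg_probability P (fun n w => dist_switch d0 pis (alphahat n w) alphas) 0.
Proof.
have [g0 _] := andP hgamma.
have sp : sbm_param alphas pis by case: htrue.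
have [h h0 hh] := affinity_gap (sbm_param_pi01 sp).
move=> eps e0.
have [eta0 eta00 hd] := usual_distance_small hd0 alphas e0.
have [t [eta [/andP[t0 t1] eta_gt0 close]]] :=
  mle_close_eventually hzeta g0 h0 eta00 htrue.
pose r n : R := Num.sqrt (ln n%:R) / n%:R.
pose Ex n := [set w | mle_exists (Q := Q) zeta gamma (adjacency X n w)].
pose D n := [set w | 1 < `| `|pihat n w - pis| / r n - 0|].
pose B n := [set w | ~~ typical alphas pis t (conflict_level t n)
  (ratio_level h t n) (labels Z n w) (adjacency X n w)].
pose err n : R := Q%:R * (2 * expR (- (t ^+ 2 / 8 * n%:R))) +
   Q%:R ^+ n * expR (ratio_level h t n - h * conflict_level t n).
have mEx n : measurable (Ex n).
  exact: (measurable_finite_event hsbm (fun _ x => mle_exists zeta gamma x)).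
have mD n : measurable (D n) by exact: measurable_mx_dist_gt.
have mB n : measurable (B n).
  exact: (measurable_finite_event hsbm (fun z x => ~~ typical alphas pis t
    (conflict_level t n) (ratio_level h t n) z x)).
have PB n : (P (B n) <= (err n)%:E)%E.
  apply: le_trans (prob_finite_event_le hsbm (fun z x => ~~ typical alphas pis t
    (conflict_level t n) (ratio_level h t n) z x)) _.
  rewrite lee_fin; apply: atypical_mass => //; last exact: ltW.
  by rewrite (ltW t0) (le_trans t1)// ler1n.
apply: (@squeeze_cvge _ _ _ _ (fun=> 0%E) _
  (fun n => (1 - P (Ex n)) + P (D n) + (err n)%:E)%E).
- near=> n; rewrite measure_ge0/= -probability_setC//.
  apply: (@le_trans _ _ (P (~` Ex n `|` D n `|` B n))).
    apply: le_measure.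
    + by rewrite inE; exact: measurable_dist_switch_gt.
    + by rewrite inE; do !apply: measurableU => //; exact: measurableC.
    (* Outside the three exceptional events the deterministic bound applies. *)
    move=> w /= dw; apply: contrapT => /not_orP[/not_orP[/contrapT ex /negP nD]].
    move=> /negP; rewrite negbK => typ.
    have cn : forall (x : 'M[bool]_n) zs alphah pih,
      is_mle zeta gamma x alphah pih -> `|pih - pis| <= eta ->
      typical alphas pis t (conflict_level t n) (ratio_level h t n) zs x ->
      exists2 s, s \in stab_pi pis &
        forall q, `|alphah 0 (s q) - alphas 0 q| < eta0 by near: n.
    have /andP[r0 re] : 0 < r n <= eta by near: n; exact: sqrt_ln_rate.
    have de : `|pihat n w - pis| <= eta.
      have q0 : 0 <= `|pihat n w - pis| / r n.
        exact: divr_ge0 (normr_ge0 _) (ltW r0).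
      apply: le_trans re; move: nD; rewrite -leNgt subr0 (ger0_norm q0).
      by rewrite ler_pdivrMr// mul1r.
    have [s sS hs] := cn _ _ _ _ (hmle n w ex) de typ.
    move: dw; rewrite subr0 ger0_norm ?dist_switch_ge0// ltNge => /negP; apply.
    apply: le_trans (dist_switch_le d0 _ _ sS) _; apply/ltW/hd => q.
    by rewrite mxE.
  apply: le_trans (measureU2 _ _ _) _ => //.
    by apply: measurableU => //; exact: measurableC.
  apply: leeD; last exact: PB.
  by apply: measureU2 => //; exact: measurableC.
- exact: cvg_cst.
- have c1 : (1 - P (Ex n))%E @[n --> \oo] --> (1 - 1)%E.
    by apply: cvgeB => //; exact: cvg_cst.
  have c2 : P (D n) @[n --> \oo] --> 0%E by exact: hrate.
  have c3 : (err n)%:E @[n --> \oo] --> 0%:E.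
    apply: cvg_EFin; first by near=> n.
    exact: atypical_mass_cvg0.
  have -> : 0%E = (1 - 1 + 0 + 0%:E)%E :> \bar R by rewrite subee// !adde0.
  by apply: cvgeD => //; apply: cvgeD.
Unshelve. all: by end_near. Qed.
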